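(* Let $\{X_n, n\ge1\}$ be a strictly stationary and ergodic sequence of random variables with common distribution function $F$. Let $h:\mathbb{R}\to\mathbb{R}$ be measurable, and for each $n$ let $c_{n1},\dots,c_{nn}$ be real constants. Define $$L_n=\frac1n\sum_{i=1}^n c_{ni}\,h(X_{n:i}),$$ where $X_{n:1}\le\dots\le X_{n:n}$ are the order statistics of $X_1,\dots,X_n$. Let $F^{-1}(t)=\inf\{x:F(x)\ge t\}$, $H(t)=h(F^{-1}(t))$, let $c_n(t)=c_{ni}$ for $t\in((i-1)/n,i/n]$, $i=1,\dots,n$, $c_n(0)=c_{n1}$, and $$\mu_n=\int_0^1 c_n(t)H(t)\,dt .$$ For $1\le q<\infty$ put $C_n(q)=n^{-1}\sum_{i=1}^n|c_{ni}|^q$, and $C_n(\infty)=\max_{i\le n}|c_{ni}|$. Suppose that one of the following conditions holds: (i) $H$ is continuous on $[0,1]$ and $\sup_{n\ge1}C_n(1)<\infty$; (ii) for some $1\le p<\infty$, $\mathbf{E}|h(X_1)|^p<\infty$ and $\sup_{n\ge1}C_n(q)<\infty$, where $1/p+1/q=1$ (so $q=\infty$ when $p=1$). Then $L_n-\mu_n\to0$ almost surely as $n\to\infty$.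
   Context: In condition (i), ''$H$ is continuous on $[0,1]$'' means that $H$ (defined by $h(F^{-1}(t))$ for $t\in(0,1)$) is, or extends to, a continuous function on the closed interval $[0,1]$. *)

(* Defs.v *)
From HB Require Import structures.
From mathcomp Require Import all_boot all_order all_algebra.
From mathcomp Require Import all_classical all_reals all_analysis.
Set Implicit Arguments. Unset Strict Implicit. Unset Printing Implicit Defensive.
Import Order.TTheory GRing.Theory Num.Theory.
Import numFieldNormedType.Exports.
Local Open Scope classical_set_scope.
Local Open Scope ring_scope.

Definition coord_sets (R : realType) : set (set (nat -> R)) :=
  [set A | exists i (B : set R), measurable B /\ A = (fun w => w i) @^-1` B].

Definition path_measurable (R : realType) (B : set (nat -> R)) : Prop :=
  smallest (sigma_algebra setT) (@coord_sets R) B.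

Definition path_shift (R : realType) (w : nat -> R) : nat -> R := fun n => w n.+1.

(* sample path of the process; X_1, X_2, ... of the paper are X 0, X 1, ... *)
Definition path_of (d : measure_display) (T : measurableType d) (R : realType)
  (X : nat -> T -> R) (w : T) : nat -> R := fun n => X n w.

Definition strictly_stationary (d : measure_display) (T : measurableType d)
  (R : realType) (P : probability T R) (X : nat -> T -> R) : Prop :=
  forall B : set (nat -> R), path_measurable B ->
    P (path_of X @^-1` B) = P ((fun w => path_shift (path_of X w)) @^-1` B).

Definition ergodic_seq (d : measure_display) (T : measurableType d)
  (R : realType) (P : probability T R) (X : nat -> T -> R) : Prop :=
  forall B : set (nat -> R), path_measurable B -> @path_shift R @^-1` B = B ->
    P (path_of X @^-1` B) = 0%E \/ P (path_of X @^-1` B) = 1%E.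

Definition distr_fun (d : measure_display) (T : measurableType d)
  (R : realType) (P : probability T R) (X : nat -> T -> R) (x : R) : R :=
  fine (P [set w | X 0%N w <= x]).

Definition quantile (R : realType) (F : R -> R) (t : R) : R :=
  inf [set x | t <= F x].

Definition order_stat (d : measure_display) (T : measurableType d)
  (R : realType) (X : nat -> T -> R) (n i : nat) (w : T) : R :=
  nth 0 (sort <=%R [seq X j w | j <- iota 0 n]) i.-1.

Definition Lstat (d : measure_display) (T : measurableType d)
  (R : realType) (X : nat -> T -> R) (h : R -> R) (c : nat -> nat -> R)
  (n : nat) (w : T) : R :=
  n%:R^-1 * \sum_(1 <= i < n.+1) c n i * h (order_stat X n i w).

Definition cfun (R : realType) (c : nat -> nat -> R) (n : nat) (t : R) : R :=
  (if t == 0 then c n 1%N else 0) +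
  \sum_(1 <= i < n.+1)
     (if ((i.-1)%:R / n%:R < t) && (t <= i%:R / n%:R) then c n i else 0).

Definition Cq (R : realType) (c : nat -> nat -> R) (n : nat) (q : R) : R :=
  n%:R^-1 * \sum_(1 <= i < n.+1) (`|c n i| `^ q).

Definition Cinf (R : realType) (c : nat -> nat -> R) (n : nat) : R :=
  \big[Num.max/0]_(1 <= i < n.+1) `|c n i|.

(* Main.v *)
(** Let [U] be the quantile function of [F] on [(0, 1)] and [V_n] the empirical quantile
    function, so that [L_n - mu_n] is the integral of [c_n (h o V_n - h o U)] over [(0, 1)].
    The strong law for [phi (X_j)] is Birkhoff's theorem for the shift on path space; by
    ergodicity it reduces to Garsia's maximal inequality applied to the invariant event
    that the partial sums are unbounded above.

    Under (ii): the Borel sets [A] such that almost surely [1_A o V_n] tends to [1_A o U] in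
    [L^1(0, 1)] form a lambda-system (the tails of a union are controlled by the strong
    law) which contains the half-lines, hence they are all the Borel sets. So the result holds
    for simple [h], and a general [h] is approximated by simple functions in [L^p] of the law of
    [X_0]; Young's inequality with a weight separates the [C_n(q)] part from the [L^p] part.

    Under (i): [h (X_j) = G (F (X_j))] almost surely, [G] being the continuous extension of [H].
    If [V_n t <= U s] then either [F (V_n t) <= s] or [V_n t = U s], so a comparison on a
    finite grid of levels [s] gives [h (V_n t) = G u] with [u] uniformly close to [t]. *)

Require Import Defs.
From HB Require Import structures.
From mathcomp Require Import all_boot all_order all_algebra.
From mathcomp Require Import all_classical all_reals all_analysis.
From mathcomp Require Import measurable_realfun ring lra.
Set Implicit Arguments. Unset Strict Implicit. Unset Printing Implicit Defensive.
Import Order.TTheory GRing.Theory Num.Theory.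
Import numFieldNormedType.Exports.
Local Open Scope classical_set_scope.
Local Open Scope ring_scope.

(** * Birkhoff's ergodic theorem *)

Section Birkhoff.
Context {d : measure_display} {Y : measurableType d} {R : realType}.
Variables (P : probability Y R) (th : {mfun Y >-> Y}).
Hypothesis th_pres : forall B, measurable B -> P (th @^-1` B) = P B.
Hypothesis th_erg : forall B, measurable B -> th @^-1` B = B ->
  P B = 0%E \/ P B = 1%E.
Implicit Type f : Y -> R.

Definition birk_sum f n (y : Y) : R := \sum_(j < n) f (iter j th y).

Lemma birk_sumS f n y : birk_sum f n.+1 y = f y + birk_sum f n (th y).
Proof.
rewrite /birk_sum big_ord_recl; congr (_ + _).
by apply: eq_bigr => i _; rewrite /bump -iterSr.
Qed.

(* [birk_max f n y] is the maximum of the [birk_sum f k y], [k <= n] *)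
Fixpoint birk_max f n (y : Y) : R :=
  if n is m.+1 then Num.max 0 (f y + birk_max f m (th y)) else 0.

Lemma birk_max_ge0 f n y : 0 <= birk_max f n y.
Proof. by case: n => //= n; rewrite le_max lexx. Qed.

Lemma birk_max_nd f n y : birk_max f n y <= birk_max f n.+1 y.
Proof.
elim: n y => [|n IH] y; first exact: birk_max_ge0.
rewrite [leLHS]/= [leRHS]/= ge_max !le_max lexx /=.
by rewrite lerD2l IH orbT.
Qed.

Lemma birk_sum_le_max f n y : birk_sum f n y <= birk_max f n y.
Proof.
elim: n y => [|n IH] y; first by rewrite /birk_sum big_ord0.
by rewrite birk_sumS /= le_max lerD2l IH orbT.
Qed.

Lemma measurable_birk_sum f n :
  measurable_fun setT f -> measurable_fun setT (birk_sum f n).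
Proof.
move=> mf; elim: n => [|n IH].
  by rewrite (_ : birk_sum f 0 = cst 0) //; apply/funext => y;
    rewrite /birk_sum big_ord0.
rewrite (_ : birk_sum f n.+1 = f \+ (birk_sum f n \o th)); last first.
  by apply/funext => y; rewrite birk_sumS.
by apply: measurable_funD => //; exact: measurableT_comp.
Qed.

Lemma measurable_birk_max f n :
  measurable_fun setT f -> measurable_fun setT (birk_max f n).
Proof.
move=> mf; elim: n => [|n IH]; first exact: measurable_cst.
apply: (@measurable_maxr _ _ _ setT (cst 0) (f \+ (birk_max f n \o th))) => //.
by apply: measurable_funD => //; exact: measurableT_comp.
Qed.

Lemma distribution_th A : measurable A -> distribution P th A = P A.
Proof. exact: th_pres. Qed.

Lemma integrable_th f : P.-integrable setT (EFin \o f) ->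
  P.-integrable setT (EFin \o (f \o th)).
Proof.
move=> fi; have [mf fint] := integrableP _ _ _ fi; apply/integrableP; split.
  apply/measurable_EFinP/measurableT_comp => //.
  exact/measurable_EFinP.
apply: le_lt_trans fint.
rewrite [leRHS](eq_measure_integral (distribution P th)) => [|A mA _];
  last by rewrite [RHS]distribution_th.
rewrite ge0_integral_distribution //.
exact: measurableT_comp.
Qed.

Lemma Rintegral_th f : P.-integrable setT (EFin \o f) ->
  Rintegral P setT (f \o th) = Rintegral P setT f.
Proof.
move=> fi; have [mf _] := integrableP _ _ _ fi; rewrite /Rintegral.
rewrite [in RHS](eq_measure_integral (distribution P th)) => [|A mA _];
  last by rewrite [RHS]distribution_th.
by rewrite integral_distribution //; exact: integrable_th.
Qed.

Lemma integrable_birk_max f n : P.-integrable setT (EFin \o f) ->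
  P.-integrable setT (EFin \o birk_max f n).
Proof.
move=> fi; have mf : measurable_fun setT f.
  by apply/measurable_EFinP; case/integrableP: fi.
elim: n => [|n IH].
  exact: (finite_measure_integrable_cst P 0).
apply: (@le_integrable _ _ _ P setT measurableT _
  (EFin \o (fun y => f y + birk_max f n (th y)))).
- by apply/measurable_EFinP; exact: measurable_birk_max.
- move=> y _ /=; rewrite lee_fin ger0_norm ?le_max ?lexx //.
  by rewrite ge_max normr_ge0 /= ler_norm.
- by have := integrableD measurableT fi (integrable_th IH).
Qed.

(* Garsia: [birk_max f n.+1 = f + birk_max f n \o th] wherever it is positive. *)
Lemma maximal_ergodic f n : P.-integrable setT (EFin \o f) ->
  0 <= \int[P]_y (f y * (\1_[set y | 0 < birk_max f n.+1 y] y : R)).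
Proof.
move=> fi; have mf : measurable_fun setT f.
  by apply/measurable_EFinP; case/integrableP: fi.
have iM := integrable_birk_max n.+1 fi.
(* By invariance [birk_max f n.+1] and its composition with [th] have the same integral, so
   comparing integrands pointwise is enough. *)
rewrite [leLHS](_ : 0 =
    \int[P]_y (birk_max f n.+1 y - (birk_max f n.+1 \o th) y)); last first.
  by rewrite RintegralB ?Rintegral_th ?subrr //; exact: integrable_th.
have mA : measurable [set y | 0 < birk_max f n.+1 y].
  rewrite -[X in measurable X]setTI.
  rewrite (_ : [set y | _] = birk_max f n.+1 @^-1` `]0, +oo[); last first.
    by apply/seteqP; split => y /=; rewrite in_itv /= andbT.
  exact: measurable_birk_max.
apply: le_Rintegral => //.
- by have := integrableB measurableT iM (integrable_th iM).
- apply: (@le_integrable _ _ _ P setT measurableT _ (EFin \o f)) => //.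
    by apply/measurable_EFinP; apply: measurable_funM => //; exact: measurable_indic.
  move=> y _ /=; rewrite lee_fin normrM indicE.
  by case: (y \in _); rewrite /= ?normr1 ?mulr1 ?normr0 ?mulr0 .
move=> y _; rewrite indicE.
have [Mpos|Mneg] := boolP (0 < birk_max f n.+1 y).
  rewrite mem_set // mulr1 lerBlDr.
  have -> : birk_max f n.+1 y = f y + birk_max f n (th y).
    by move: Mpos; rewrite /= lt_max ltxx /= => /ltW ?; apply/max_idPr.
  by rewrite lerD2l birk_max_nd.
rewrite memNset ?mulr0; last by move=> /=; apply/negP.
(* Off the event the maximum is at most 0, while its shift is still nonnegative. *)
rewrite subr_le0; apply: le_trans (birk_max_ge0 _ _ _).
by rewrite leNgt.
Qed.

(** The events [0 < birk_max f n.+1] increase to an event of full measure, so Garsia's inequality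
    passes to the limit by dominated convergence with bound [|f|]. *)
Lemma Rintegral_ge0_of_birk_sum f : P.-integrable setT (EFin \o f) ->
  {ae P, forall y, exists n, 0 < birk_sum f n y} ->
  0 <= \int[P]_y f y.
Proof.
move=> fi fpos; have mf : measurable_fun setT f.
  by apply/measurable_EFinP; case/integrableP: fi.
pose g n y := f y * (\1_[set y | 0 < birk_max f n.+1 y] y : R).
have mg n : measurable_fun setT (g n).
  apply: measurable_funM => //; apply: measurable_indic.
  rewrite -[X in measurable X]setTI.
  rewrite (_ : [set y | _] = birk_max f n.+1 @^-1` `]0, +oo[); last first.
    by apply/seteqP; split => y /=; rewrite in_itv /= andbT.
  exact: measurable_birk_max.
have [] := @dominated_convergence _ _ _ P setT measurableT
  (fun n => EFin \o g n) (EFin \o f) (abse \o (EFin \o f)).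
- by move=> n; exact/measurable_EFinP.
- exact/measurable_EFinP.
- apply: filterS fpos => y [n npos] _.
  apply: (@cvg_near_cst _ _ _ _ (nbhs \oo)).
  exists n => // k /= nk; rewrite /g indicE mem_set ?mulr1 //=.
  have {}npos : 0 < birk_max f n y := lt_le_trans npos (birk_sum_le_max _ _ _).
  apply: lt_le_trans npos _.
  by apply: (@homo_leq _ (birk_max f ^~ y) <=%R lexx le_trans
    (fun n => birk_max_nd f n y) n k.+1 (leqW nk)).
- exact: integrable_abse.
- apply: aeW => y n _; rewrite /= /g lee_fin normrM indicE.
  by case: (y \in _); rewrite ?normr1 ?mulr1 ?normr0 ?mulr0.
move=> _ _ gf.
have {}gf : \int[P]_y g n y @[n --> \oo] --> \int[P]_y f y.
  apply: fine_cvg; rewrite fineK; last exact: integrable_fin_num.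
  exact: gf.
rewrite -(cvg_lim _ gf) //; apply: limr_ge; first by apply/cvg_ex; eexists; exact: gf.
by apply: nearW => n; exact: maximal_ergodic.
Qed.

(** The event [B] that the partial sums are unbounded above is invariant. If it had probability 1,
    some partial sum would be positive almost surely, and the integral of [f] would be
    nonnegative. *)
Lemma birk_sum_bounded f : P.-integrable setT (EFin \o f) ->
  \int[P]_y f y < 0 ->
  {ae P, forall y, exists K : nat, forall n, birk_sum f n y <= K%:R}.
Proof.
move=> fi fneg; have mf : measurable_fun setT f.
  by apply/measurable_EFinP; case/integrableP: fi.
pose B := \bigcap_(K : nat) \bigcup_n [set y | K%:R < birk_sum f n y].
have mB : measurable B.
  apply: bigcapT_measurable => K; apply: bigcupT_measurable => n.
  rewrite -[X in measurable X]setTI.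
  rewrite (_ : [set y | _] = birk_sum f n @^-1` `]K%:R, +oo[); last first.
    by apply/seteqP; split => y /=; rewrite in_itv /= andbT.
  exact: measurable_birk_sum.
(* Shifting changes a partial sum by the single term [f y]; in both directions, raising the level by
   a bound on [|f y|] absorbs it. *)
have BE : th @^-1` B = B.
  apply/seteqP; split => y /= By K _.
    have [n _ /= Kn] := By (K + Num.bound `|f y|)%N I.
    exists n.+1 => //=; rewrite birk_sumS.
    move: Kn; rewrite natrD.
    have := archi_boundP (normr_ge0 (f y)).
    have := ler_norm (- f y); rewrite normrN; lra.
  have [[|n] _ /= Kn] := By (K + Num.bound `|f y|)%N I.
    by move: Kn; rewrite /birk_sum big_ord0 ltNge ler0n.
  exists n => //=; move: Kn; rewrite birk_sumS natrD.
  have := archi_boundP (normr_ge0 (f y)); have := ler_norm (f y); lra.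
have [B0|B1] := th_erg mB BE.
  exists B; split => // y /= /forallNP yK K _.
  have /existsNP[n /negP] := yK K; rewrite -ltNge => ?.
  by exists n.
exfalso; move: fneg; apply/negP; rewrite -leNgt.
apply: Rintegral_ge0_of_birk_sum => //.
exists (~` B); split; first exact: measurableC.
  by rewrite probability_setC // B1 subee.
move=> y /= nex By; apply: nex; have [n _ /= ?] := By 0%N I.
by exists n.
Qed.

End Birkhoff.

Section ErgodicTheorem.
Context {d : measure_display} {Y : measurableType d} {R : realType}.
Variables (P : probability Y R) (th : {mfun Y >-> Y}).
Hypothesis th_pres : forall B, measurable B -> P (th @^-1` B) = P B.
Hypothesis th_erg : forall B, measurable B -> th @^-1` B = B ->
  P B = 0%E \/ P B = 1%E.

(** Boundedness of partial sums, applied to [f - a], whose integral is negative. *)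
Lemma birk_sum_linear_bound (f : Y -> R) a : P.-integrable setT (EFin \o f) ->
  \int[P]_y f y < a ->
  {ae P, forall y, exists K : nat, forall n, birk_sum th f n y <= n%:R * a + K%:R}.
Proof.
move=> fi fa.
have ia : P.-integrable setT (EFin \o cst a) := finite_measure_integrable_cst P a measurableT.
have : {ae P, forall y, exists K : nat, forall n,
    birk_sum th (fun y => f y - a) n y <= K%:R}.
  apply: (birk_sum_bounded th_pres th_erg).
    by have := integrableB measurableT fi ia.
  rewrite RintegralB // Rintegral_cst // (_ : fine _ = 1) ?mulr1; last first.
    exact: (congr1 fine (probability_setT P)).
  by rewrite subr_lt0.
apply: filterS => y [K yK]; exists K => n; have := yK n.
rewrite /birk_sum big_split /= sumr_const card_ord -[X in _ + X]mulr_natl mulrN.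
by rewrite lerBlDl.
Qed.

(** Linear bounds with slopes arbitrarily close to the mean, for [f] and for [- f], squeeze the
    averages; the additive constants vanish after division by [n]. *)
Theorem birkhoff (f : Y -> R) : P.-integrable setT (EFin \o f) ->
  {ae P, forall y, (fun n => n%:R^-1 * birk_sum th f n y) @ \oo --> \int[P]_z f z}.
Proof.
move=> fi; set m := Rintegral _ _ _.
have fNi : P.-integrable setT (EFin \o (\- f)).
  by rewrite (_ : EFin \o _ = \- (EFin \o f))%E //; exact: integrableN.
have up : {ae P, forall y, forall k : nat, exists K : nat, forall n,
    birk_sum th f n y <= n%:R * (m + k.+1%:R^-1) + K%:R}.
  apply: ae_foralln => k; apply: birk_sum_linear_bound => //.
  by rewrite ltrDl invr_gt0.
have lo : {ae P, forall y, forall k : nat, exists K : nat, forall n,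
    birk_sum th (\- f) n y <= n%:R * (- m + k.+1%:R^-1) + K%:R}.
  apply: ae_foralln => k; apply: birk_sum_linear_bound => //.
  rewrite [X in X < _](_ : _ = - m) ?ltrDl ?invr_gt0 //.
  have -> : Rintegral P setT (\- f) = \int[P]_y ((-1) * f y).
    by apply: eq_Rintegral => y _; rewrite mulN1r.
  by rewrite RintegralZl // mulN1r.
apply: filterS2 up lo => y up lo; apply/cvgrPdist_le => e e0.
(* [k] makes the slope error at most [e / 2]; [N] below makes the additive constants at most
   [n * e / 2]. *)
pose k := Num.bound (2 / e).
have ke : k.+1%:R^-1 <= e / 2.
  rewrite -[leRHS]invrK invf_div lef_pV2 ?posrE ?divr_gt0 //.
  apply: le_trans (ltW (archi_boundP _)) _; first by rewrite divr_ge0 // ltW.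
  by rewrite ler_nat leqnSn.
have [K1 up1] := up k; have [K2 lo2] := lo k.
pose N := Num.bound (2 * (K1 + K2)%:R / e).
have NB : 2 * (K1 + K2)%:R / e < N%:R.
  by apply: archi_boundP; rewrite divr_ge0 // ?mulr_ge0 // ltW.
exists N.+1 => // n /= Nn.
have n0 : 0 < n%:R :> R by rewrite ltr0n (leq_trans _ Nn).
have nN : N%:R <= n%:R :> R by rewrite ler_nat ltnW.
rewrite distrC -(ler_pM2l n0).
rewrite -[X in X * `|_|](gtr0_norm n0) -normrM mulrBr mulrA mulfV ?gt_eqF // mul1r.
have := up1 n; have := lo2 n.
rewrite {1}/birk_sum sumrN -/(birk_sum th f n y).
move: NB; rewrite natrD ltr_pdivrMr // => NB lo' up'.
have K1p : 0 <= K1%:R :> R by []; have K2p : 0 <= K2%:R :> R by [].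
have Ne : N%:R * e <= n%:R * e by rewrite ler_wpM2r // ltW.
have nk : n%:R * k.+1%:R^-1 <= n%:R * (e / 2) by rewrite ler_wpM2l.
move: nk lo' up' Ne NB; rewrite !mulrDr ler_norml mulrA mulrN.
move: (_ / k.+1%:R) (n%:R * m) (n%:R * e) (N%:R * e) => u v w z.
by move=> *; apply/andP; split; lra.
Qed.

End ErgodicTheorem.

(** * The strong law along a stationary ergodic sequence *)

Section StationarySequences.
Context {d : measure_display} {T : measurableType d} {R : realType}.
Variables (P : probability T R) (X : nat -> T -> R).
Hypothesis mX : forall n, measurable_fun setT (X n).
Hypothesis statX : strictly_stationary P X.
Hypothesis ergX : ergodic_seq P X.

(** Paths with the sigma-algebra generated by the coordinates: measurability there is
    [path_measurable], so the hypotheses on [X] say that the shift preserves the law of the process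
    and is ergodic for it. *)
Local Notation path := (g_sigma_algebraType (@coord_sets R)).

Lemma measurable_coord n : measurable_fun setT ((fun w => w n) : path -> R).
Proof.
move=> _ B mB; rewrite setTI; apply: sub_sigma_algebra.
by exists n, B.
Qed.

Lemma measurable_to_path {d'} {S : measurableType d'} (f : S -> path) :
  (forall n, measurable_fun setT (fun s => f s n)) -> measurable_fun setT f.
Proof.
move=> mf; apply: (@measurability _ _ S path setT f (@coord_sets R)) => //.
move=> _ [_ [n [B [mB ->]]] <-].
exact: (mf n).
Qed.

Lemma measurable_path_of : measurable_fun setT (path_of X : T -> path).
Proof. exact: measurable_to_path. Qed.

Lemma measurable_path_shift : measurable_fun setT (@path_shift R : path -> path).
Proof. by apply: measurable_to_path => n; exact: measurable_coord. Qed.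

Let xi : {mfun T >-> path} := HB.pack (path_of X : T -> path)
  (isMeasurableFun.Build _ _ _ _ (path_of X : T -> path) measurable_path_of).
Let sh : {mfun path >-> path} := HB.pack (@path_shift R : path -> path)
  (isMeasurableFun.Build _ _ _ _ (@path_shift R : path -> path) measurable_path_shift).

Lemma iter_path_shift j (w : nat -> R) : iter j (@path_shift R) w 0%N = w j.
Proof.
have H : forall k, iter j (@path_shift R) w k = w (j + k)%N.
  by elim: j => [|j IH] k //=; rewrite /path_shift IH addSnnS.
by rewrite H addn0.
Qed.

(** Birkhoff's theorem for the shift under the law of the process, applied to [phi] of the
    coordinate 0; the exceptional null set of paths is pulled back along [xi]. *)
Theorem ergodic_average (phi : R -> R) : measurable_fun setT phi ->
  P.-integrable setT (EFin \o (phi \o X 0%N)) ->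
  {ae P, forall w, (fun n => n%:R^-1 * \sum_(j < n) phi (X j w)) @ \oo -->
    \int[P]_z phi (X 0%N z)}.
Proof.
move=> mphi phii.
have shE B : measurable B -> distribution P xi (sh @^-1` B) = distribution P xi B.
  by move=> mB; rewrite /distribution /pushforward /= [RHS]statX.
have shI B : measurable B -> sh @^-1` B = B ->
    distribution P xi B = 0%E \/ distribution P xi B = 1%E.
  exact: ergX.
pose f : path -> R := fun w => phi (w 0%N).
have mf : measurable_fun setT f.
  by apply: measurableT_comp => //; exact: measurable_coord.
have fi : (distribution P xi).-integrable setT (EFin \o f).
  by apply: integrable_pushforward => //; exact/measurable_EFinP.
have [N [mN N0 subN]] := birkhoff shE shI fi.
exists (xi @^-1` N); split => //.
  by rewrite -[X in measurable X]setTI; exact: measurable_funP.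
move=> w /= wN; apply: subN => /= H; apply: wN.
have {H} : (fun n => n%:R^-1 * birk_sum sh f n (xi w)) @ \oo -->
    Rintegral (distribution P xi) setT f by [].
rewrite {1}/Rintegral integral_distribution //; last exact/measurable_EFinP.
apply: cvg_trans; apply: near_eq_cvg; apply: nearW => n.
congr (_ * _); apply: eq_bigr => j _.
by rewrite /f iter_path_shift.
Qed.

End StationarySequences.

(** * Quantile functions *)

Section UniformMeasure.
Context {R : realType}.

(** Lebesgue measure on the unit interval packed as a probability, so that a quantile function
    becomes a random variable with a [distribution]. *)
Definition unif01 : probability (measurableTypeR R) R := uniform_prob (@ltr01 R).

Lemma integral_unif01 (f : R -> \bar R) :
  measurable_fun setT f -> (forall x, (0 <= f x)%E) ->
  (\int[unif01]_x f x = \int[lebesgue_measure]_(x in `]0%R, 1%R[) f x)%E.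
Proof.
move=> mf f0; rewrite integral_uniform // subr0 invr1 mul1e.
by rewrite integral_itv_bndoo //; exact: measurable_funTS.
Qed.

(** The endpoints are null, so the comparison is required only on the open interval, where quantile
    functions obey their inequalities. *)
Lemma le_integral_unif01 (f g : R -> \bar R) :
  measurable_fun setT f -> (forall x, (0 <= f x)%E) ->
  measurable_fun setT g -> (forall x, (0 <= g x)%E) ->
  (forall x, 0 < x < 1 -> (f x <= g x)%E) ->
  (\int[unif01]_x f x <= \int[unif01]_x g x)%E.
Proof.
move=> mf f0 mg g0 fg; rewrite !integral_unif01 //.
by apply: ge0_le_integral => //; exact: measurable_funTS.
Qed.

Lemma eq_integral_unif01 (f g : R -> \bar R) :
  measurable_fun setT f -> (forall x, (0 <= f x)%E) ->
  measurable_fun setT g -> (forall x, (0 <= g x)%E) ->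
  (forall x, 0 < x < 1 -> f x = g x) ->
  (\int[unif01]_x f x = \int[unif01]_x g x)%E.
Proof.
move=> mf f0 mg g0 fg; rewrite !integral_unif01 //.
by apply: eq_integral => x; rewrite inE /= in_itv /= => /fg.
Qed.

Lemma unif01_initial (A : set R) (a : R) : measurable A -> 0 <= a <= 1 ->
  (forall t, 0 < t < 1 -> A t <-> t <= a) -> unif01 A = a%:E.
Proof.
move=> mA /andP[a0 a1] Aa.
transitivity (\int[unif01]_x (\1_A x)%:E)%E.
  by rewrite integral_indic // setIT.
rewrite (@eq_integral_unif01 _ (fun x => (\1_(`]0%R, a]%classic) x)%:E)).
- rewrite integral_unif01 //; last exact/measurable_EFinP.
  rewrite -(@integral_itv_bndoo _ _ _ _ false false); last first.
    exact/measurable_EFinP/measurable_funTS.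
  rewrite integral_indic //.
  rewrite (_ : _ `&` _ = `]0, a]%classic); last first.
    apply/seteqP; split => x /=; rewrite !in_itv /=; first by case.
    by move=> /andP[x0 xa]; rewrite x0 xa (le_trans xa).
  by rewrite /= lebesgue_measure_itv /= lte_fin sube0; case: ltgtP a0 => // <-.
- exact/measurable_EFinP.
- by move=> x; rewrite lee_fin.
- exact/measurable_EFinP.
- by move=> x; rewrite lee_fin.
move=> x x01; rewrite !indicE; congr (_%:R%:E).
have [xa|xa] := boolP (x <= a).
  by rewrite !mem_set //=; [rewrite in_itv /= xa andbT; case/andP: x01|apply/Aa].
by rewrite !memNset //=; [rewrite in_itv /= (negbTE xa) andbF|move/(Aa _ x01); apply/negP].
Qed.

End UniformMeasure.

(** * The quantile function of [F] and the inverse transform *)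

Section Quantile.
Context {d : measure_display} {T : measurableType d} {R : realType}.
Variables (P : probability T R) (X : nat -> T -> R).
Hypothesis mX : forall n, measurable_fun setT (X n).

Let X0 : {mfun T >-> R} := HB.pack (X 0%N)
  (isMeasurableFun.Build _ _ _ _ (X 0%N) (mX 0%N)).
Let F := distr_fun P X.

(** Gives access to the limits at infinity and the right continuity known for [cdf]. *)
Lemma distr_funE x : (F x)%:E = cdf (X0 : {RV P >-> R}) x.
Proof.
rewrite /F /distr_fun /cdf /distribution /pushforward fineK.
  by congr (P _); apply/seteqP; split => y /=; rewrite in_itv.
apply: fin_num_measure.
rewrite (_ : [set w | _] = X0 @^-1` `]-oo, x]); last first.
  by apply/seteqP; split => y /=; rewrite in_itv.
by rewrite -[X in measurable X]setTI; exact: measurable_funP.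
Qed.

Lemma distr_fun_nd : {homo F : x y / x <= y}.
Proof. by move=> x y xy; rewrite -lee_fin !distr_funE; exact: cdf_nondecreasing. Qed.

Lemma distr_fun_ge0 x : 0 <= F x.
Proof. by rewrite -lee_fin distr_funE cdf_ge0. Qed.

Lemma distr_fun_le1 x : F x <= 1.
Proof. by rewrite -lee_fin distr_funE cdf_le1. Qed.

(** The Galois connection between [F] and its quantile function. The limits of [F] at both
    infinities make the set of [x] with [t <= F x] nonempty and bounded below; right continuity puts
    its infimum in the set. *)
Lemma quantile_le t x : 0 < t < 1 -> (quantile F t <= x) = (t <= F x).
Proof.
move=> /andP[t0 t1].
have cdfF : cdf (X0 : {RV P >-> R}) = EFin \o F.
  by apply/funext => y; rewrite /= distr_funE.
have [b tb] : exists b, t <= F b.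
  have := @cvg_cdfy1 _ _ _ P X0; rewrite cdfF => /fine_cvgP[_ /cvgrPdist_lt].
  move=> /(_ (1 - t)); rewrite subr_gt0 => /(_ t1) [M [_ HM]].
  exists (M + 1); have := HM (M + 1); rewrite ltrDl ltr01 => /(_ isT) /=.
  by rewrite ltr_norml => /andP[_]; rewrite ltrD2l ltrN2 => /ltW.
have [a at_] : exists a, F a < t.
  have := @cvg_cdfNy0 _ _ _ P X0; rewrite cdfF => /fine_cvgP[_ /cvgrPdist_lt].
  move=> /(_ t t0) [M [_ HM]].
  exists (M - 1); have := HM (M - 1); rewrite gtrBl ltr01 => /(_ isT) /=.
  by rewrite sub0r normrN => /(le_lt_trans (ler_norm _)).
have lbS : has_lbound [set x | t <= F x].
  exists a => y /= ty; rewrite leNgt; apply/negP => /ltW /distr_fun_nd Fya.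
  by move: (le_lt_trans (le_trans ty Fya) at_); rewrite ltxx.
apply/idP/idP => [qx|tx]; last exact: ge_inf.
apply: le_trans (distr_fun_nd qx).
(* If [F] were below [t] at the infimum, right continuity would keep it below [t] at distance
   [e / 2] to the right, yet the set has a point before that. *)
rewrite -/(quantile F t) leNgt; apply/negP => Fq.
have := @cdf_right_continuous _ _ _ P X0 (quantile F t).
rewrite cdfF => /fine_cvgP[_ /cvgrPdist_lt /(_ (t - F (quantile F t)))].
rewrite subr_gt0 => /(_ Fq) [e /= e0 He].
have [y /= ty yq] : exists2 y, t <= F y & y < quantile F t + e / 2.
  have := @inf_adherent _ [set x | t <= F x] (e / 2).
  by rewrite divr_gt0 // => /(_ isT); apply; split => //; exists b.
have {}yq : F y <= F (quantile F t + e / 2) by apply: distr_fun_nd; exact: ltW.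
have := He (quantile F t + e / 2).
rewrite /= opprD addNKr normrN gtr0_norm ?divr_gt0 //.
rewrite ltr_pdivrMr // ltr_pMr // ltr1n => /(_ isT).
rewrite ltrDl divr_gt0 // => /(_ isT).
rewrite ltr_distl => /andP[+ _]; move: ty yq; lra.
Qed.

Lemma quantile_nd s t : 0 < s -> s <= t -> t < 1 -> quantile F s <= quantile F t.
Proof.
move=> s0 st t1; have s01 : 0 < s < 1 by rewrite s0 (le_lt_trans st).
have t01 : 0 < t < 1 by rewrite t1 (lt_le_trans s0).
by rewrite quantile_le // (le_trans st) // -quantile_le.
Qed.

(* off [(0, 1)] the value of [quantile] is the infimum of [setT] or of a set that may be empty *)
Definition quantile01 (t : R) : R := if 0 < t < 1 then quantile F t else 0.

Lemma quantile01E t : 0 < t < 1 -> quantile01 t = quantile F t.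
Proof. by rewrite /quantile01 => ->. Qed.

Lemma measurable_quantile01 : measurable_fun setT quantile01.
Proof.
apply: (measurability _ (RGenOInfty.measurableE R)) => //.
move=> _ [_ [x ->] <-]; rewrite setTI.
(* The second piece accounts for the default value 0 off the open unit interval. *)
rewrite (_ : _ @^-1` _ = (`]0, 1[ `&` `]F x, +oo[) `|`
    (if x < 0 then ~` `]0, 1[ else set0)); last first.
  apply/seteqP; split => t /=; rewrite !in_itv /= !andbT /quantile01.
    have [t01|t01] := boolP (0 < t < 1).
      by rewrite ltNge quantile_le // -ltNge => Ft; left.
    by move=> ->; right => /=; rewrite in_itv /=; apply/negP.
  case=> [[t01 Ft]|]; first by rewrite t01 ltNge quantile_le // -ltNge.
  by case: (ltP x 0) => // x0 /=; rewrite in_itv /= => /negP/negbTE ->.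
by apply: measurableU; [exact: measurableI|case: ifP => // _; exact: measurableC].
Qed.

Let mU : @measurable_fun _ _ (measurableTypeR R) R setT quantile01.
Proof. exact: measurable_quantile01. Qed.

Let U : {mfun measurableTypeR R >-> R} := HB.pack quantile01
  (isMeasurableFun.Build _ _ (measurableTypeR R) R quantile01 mU).

(** Finite measures that agree on the pi-system of open right half-lines agree. The complement of
    such a half-line pulls back to the levels [t <= F x], of length [F x]. *)
Lemma quantile_transform_measure A : measurable A ->
  distribution unif01 U A = distribution P X0 A.
Proof.
move=> mA; apply: (@measure_unique _ R R (@RGenOInfty.G R)
  (fun n => `](- n%:R), +oo[%classic) _ _ _ _ (distribution unif01 U) (distribution P X0)) => //.
- exact: RGenOInfty.measurableE.
- move=> _ _ [x ->] [y ->]; exists (Num.max x y).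
  by apply/seteqP; split => z /=; rewrite !in_itv /= !andbT gt_max;
    [case=> -> ->|move/andP].
- by move=> n; exists (- n%:R).
- apply/seteqP; split => // x _; exists (Num.bound `|x|) => //=.
  rewrite in_itv /= andbT ltrNl; apply: le_lt_trans (archi_boundP (normr_ge0 x)).
  by rewrite -normrN ler_norm.
- move=> _ [x ->].
  rewrite -[X in distribution _ _ X = distribution _ _ X]setCK setCitvr.
  rewrite !probability_setC //; congr (_ - _)%E.
  rewrite -[RHS]/(cdf (X0 : {RV P >-> R}) x) -distr_funE.
  apply: unif01_initial.
  + by rewrite -[X in measurable X]setTI; exact: measurable_quantile01.
  + by rewrite distr_fun_ge0 distr_fun_le1.
  + by move=> t t01; rewrite /= in_itv /= quantile01E // quantile_le.
- by move=> n; apply: le_lt_trans (probability_le1 _ _) _; rewrite ?ltry.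
Qed.

Lemma integral_quantile01 (f : R -> \bar R) :
  measurable_fun setT f -> (forall x, (0 <= f x)%E) ->
  (\int[unif01]_t f (quantile01 t) = \int[P]_w f (X 0%N w))%E.
Proof.
move=> mf f0.
rewrite -(@ge0_integral_distribution _ _ _ _ _ unif01 U f) //.
rewrite -(@ge0_integral_distribution _ _ _ _ _ P X0 f) //.
by apply: eq_measure_integral => A mA _; exact: quantile_transform_measure.
Qed.

End Quantile.

(** * Empirical quantile functions *)

Section StepFunctions.
Context {R : realType}.
Implicit Types (a c : nat -> nat -> R).

(** The index is the least [i] with [t <= i / n]. It is chosen before [c], so several step functions
    on the same grid can be evaluated at one index. *)
Lemma cfun_cell n (t : R) : (0 < n)%N -> 0 < t <= 1 ->
  exists i, [/\ (0 < i <= n)%N, (i.-1)%:R / n%:R < t, t <= i%:R / n%:R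
    & forall c, cfun c n t = c n i].
Proof.
move=> n0 /andP[t0 t1].
have n0R : 0 < n%:R :> R by rewrite ltr0n.
have ex : exists i, t <= i%:R / n%:R by exists n; rewrite divff ?gt_eqF.
case: (ex_minnP ex) => i ti mini.
have i0 : (0 < i)%N.
  by rewrite lt0n; apply/eqP => i0; move: ti; rewrite i0 mul0r leNgt t0.
have it : (i.-1)%:R / n%:R < t.
  rewrite ltNge; apply/negP => /mini.
  by case: i i0 {ti mini} => // i _; rewrite ltnn.
have i_n : (i <= n)%N by apply: mini; rewrite divff ?gt_eqF.
exists i; split => //; first by rewrite i0.
move=> c; rewrite /cfun gt_eqF // add0r.
rewrite -big_mkcond /=.
rewrite (eq_bigl (pred1 i)); last first.
  move=> k /=; apply/andP/eqP => [[kt tk]|->]; last by [].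
  apply/eqP; rewrite eqn_leq mini // andbT.
  rewrite leqNgt; apply/negP => ik.
  have : i%:R / n%:R <= (k.-1)%:R / n%:R :> R.
    by rewrite ler_pM2r ?invr_gt0 // ler_nat -ltnS (ltn_predK ik).
  by move=> /(le_trans ti); rewrite leNgt kt.
rewrite -big_filter filter_pred1_uniq ?iota_uniq ?mem_index_iota ?i0 //.
by rewrite big_seq1.
Qed.

Definition cell n i : set R := `](i.-1)%:R / n%:R, i%:R / n%:R]%classic.

Lemma measurable_cell n i : measurable (cell n i).
Proof. exact: measurable_itv. Qed.

(** Reduces measurability and integration to indicators by linearity; the first term carries the
    separate value at 0. *)
Lemma cfun_indic c n (t : R) : cfun c n t = c n 1%N * \1_[set 0] t +
  \sum_(1 <= i < n.+1) c n i * \1_(cell n i) t.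
Proof.
have ind (A : set R) (b : bool) x : (b <-> A t) ->
    (if b then x else 0) = x * \1_A t :> R.
  move=> bA; rewrite indicE; case: ifPn => [/bA At|/negP nb].
    by rewrite mem_set ?mulr1.
  by rewrite memNset ?mulr0 // => /bA.
rewrite /cfun; congr (_ + _).
  by apply: ind; split => /= [/eqP//|->].
by apply: eq_bigr => i _; apply: ind; rewrite /cell /= in_itv.
Qed.

Lemma measurable_cfun c n : measurable_fun setT (cfun c n).
Proof.
rewrite (_ : cfun c n = (fun t => c n 1%N * \1_[set 0] t) \+ (fun t =>
    \sum_(1 <= i < n.+1) c n i * \1_(cell n i) t)); last first.
  by apply/funext => t; exact: cfun_indic.
apply: measurable_funD.
  by apply: measurable_funM => //; apply: measurable_indic; exact: measurable_set1.
apply: measurable_sum => i.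
by apply: measurable_funM => //; apply: measurable_indic; exact: measurable_cell.
Qed.

Let mu := @lebesgue_measure R.

Lemma integrable_indic_cell n i :
  mu.-integrable `]0, 1[ (EFin \o (\1_(cell n i) : R -> R)).
Proof.
by apply: (integrableS measurableT) => //; exact: integrable_indic_itv.
Qed.

Lemma integrable_cell n i x :
  mu.-integrable `]0, 1[ (EFin \o (fun t => x * \1_(cell n i) t)).
Proof.
have H := integrable_indic_cell n i.
have mD : measurable (`]0, 1[%classic : set R) by exact: measurable_itv.
have := @integrableZl _ _ _ mu _ mD x _ H.
by [].
Qed.

Lemma integrable_cfun a n : (0 < n)%N ->
  mu.-integrable `]0, 1[ (EFin \o cfun a n) /\
  \int[mu]_(t in `]0, 1[) cfun a n t = n%:R^-1 * \sum_(1 <= i < n.+1) a n i.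
Proof.
move=> n0; pose g t := \sum_(1 <= i < n.+1) a n i * \1_(cell n i) t.
have ag t : t \in `]0, 1[%classic -> cfun a n t = g t.
  rewrite inE /= in_itv /= => /andP[t0 _].
  (* On the open interval the term at 0 disappears. *)
  by rewrite cfun_indic indicE memNset ?mulr0 ?add0r //= => t00; rewrite t00 ltxx in t0.
have gE : EFin \o g = (fun t => \sum_(1 <= i < n.+1) (a n i * \1_(cell n i) t)%:E)%E.
  by apply/funext => t; rewrite /= sumEFin.
have gi : mu.-integrable `]0, 1[ (EFin \o g).
  by rewrite gE; apply: integrable_sum => // i _; exact: integrable_cell.
split; first by apply: eq_integrable gi => // t /ag /= ->.
rewrite (@eq_Rintegral _ _ _ mu _ g) // /Rintegral.
rewrite (_ : (fun x => (g x)%:E) = EFin \o g) // gE integral_sum //; last first.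
  by move=> i; exact: integrable_cell.
rewrite mulr_sumr (eq_big_nat _ _ (F2 := fun i => (n%:R^-1 * a n i)%:E)).
  by rewrite sumEFin.
move=> i /andP[i0 ilen].
under eq_integral do rewrite EFinM.
rewrite integralZl //; last exact: integrable_indic_cell.
rewrite mulrC EFinM; congr (_ * _)%E.
rewrite -(@integral_itv_bndoo _ _ _ _ false false); last first.
  by apply/measurable_EFinP/measurable_funTS/measurable_indic; exact: measurable_cell.
rewrite integral_indic; [|exact: measurable_itv|exact: measurable_cell].
have n0R : 0 < n%:R :> R by rewrite ltr0n.
rewrite (_ : _ `&` _ = cell n i); last first.
  apply/seteqP; split => t /=; first by case.
  move=> H; split => //; move: H; rewrite /cell /= !in_itv /= => /andP[t0 t1].
  rewrite (le_lt_trans _ t0) ?divr_ge0 //= (le_trans t1) //.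
  by rewrite ler_pdivrMr // mul1r ler_nat -ltnS.
rewrite /cell /= lebesgue_measure_itv /= lte_fin.
rewrite ltr_pM2r ?invr_gt0 // ltr_nat ltn_predL i0 -EFinB -mulrBl.
by rewrite -natrB ?leq_pred // -subn1 subKn // mul1r.
Qed.

Lemma integral_unif01_cfun a n : (0 < n)%N -> (forall i, 0 <= a n i) ->
  (\int[unif01]_t (cfun a n t)%:E = (n%:R^-1 * \sum_(1 <= i < n.+1) a n i)%:E)%E.
Proof.
move=> n0 a0; have [ai <-] := integrable_cfun a n0.
rewrite integral_unif01.
- by rewrite /Rintegral fineK //; exact: integrable_fin_num.
- by apply/measurable_EFinP; exact: measurable_cfun.
move=> t; rewrite lee_fin cfun_indic addr_ge0 ?mulr_ge0 //.
by apply: sumr_ge0 => i _; rewrite mulr_ge0.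
Qed.

End StepFunctions.

(** * Order statistics and counting *)

Section OrderStatistics.
Context {d : measure_display} {T : measurableType d} {R : realType}.
Variable X : nat -> T -> R.
Let Xs n w := [seq X j w | j <- iota 0 n].

Lemma sum_order_stat (f : R -> R) n w :
  \sum_(1 <= i < n.+1) f (order_stat X n i w) = \sum_(j < n) f (X j w).
Proof.
rewrite big_add1 /= /order_stat /=.
have sz : size (sort <=%R (Xs n w)) = n by rewrite size_sort size_map size_iota.
rewrite -[X in \sum_(0 <= i < X) _]sz -(big_nth 0 xpredT f).
rewrite (perm_big (Xs n w)) /=; last by apply/permPl/perm_sort.
by rewrite big_map -{1}[n in iota 0 n]subn0 -/(index_iota 0 n) big_mkord.
Qed.

Lemma count_indic (p : pred R) n w :
  (count p (Xs n w))%:R = \sum_(j < n) (p (X j w))%:R :> R.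
Proof.
rewrite -sum1_count natr_sum big_mkcond /= big_map.
rewrite -{1}[n in iota 0 n]subn0 -/(index_iota 0 n) big_mkord.
by apply: eq_bigr => i _; case: (p _).
Qed.

(** In the sorted sample the entries at most [x] come first, so comparing an order statistic with
    [x] amounts to comparing its rank with their number. The rank starts at 1, the index of [nth] at
    0. *)
Lemma order_stat_le n i w x : (0 < i <= n)%N ->
  (order_stat X n i w <= x) = (i <= count (fun y => (y <= x)%R) (Xs n w))%N.
Proof.
move=> /andP[i0 i_n]; rewrite /order_stat -/(Xs n w).
have st : sorted <=%R (sort <=%R (Xs n w)) by exact: sort_le_sorted.
rewrite -(count_sort <=%R).
have [ic|ci] := leqP i (count _ _); first by apply: nth_count_le => //; rewrite prednK.
apply/negbTE; rewrite -ltNge; apply: nth_count_gt => //.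
by rewrite -ltnS prednK // ci size_sort size_map size_iota.
Qed.

Lemma order_stat_lt n i w x : (0 < i <= n)%N ->
  (order_stat X n i w < x) = (i <= count (fun y => (y < x)%R) (Xs n w))%N.
Proof.
move=> /andP[i0 i_n]; rewrite /order_stat -/(Xs n w).
have st : sorted <=%R (sort <=%R (Xs n w)) by exact: sort_le_sorted.
rewrite -(count_sort <=%R).
have [ic|ci] := leqP i (count _ _); first by apply: nth_count_lt => //; rewrite prednK.
apply/negbTE; rewrite -leNgt; apply: nth_count_ge => //.
by rewrite -ltnS prednK // ci size_sort size_map size_iota.
Qed.

End OrderStatistics.

(** * The empirical quantile function and the L-statistic *)

Section EmpiricalQuantile.
Context {d : measure_display} {T : measurableType d} {R : realType}.
Variables (P : probability T R) (X : nat -> T -> R).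
Hypothesis mX : forall n, measurable_fun setT (X n).
Let U := quantile01 P X.

(* equal to the [i]-th order statistic on [((i - 1) / n, i / n]] *)
Definition emp_quantile n w (t : R) : R := cfun (fun n i => order_stat X n i w) n t.

Definition emp_mean (f : R -> R) n w : R := n%:R^-1 * \sum_(j < n) f (X j w).

Lemma measurable_emp_quantile n w : measurable_fun setT (emp_quantile n w).
Proof. exact: measurable_cfun. Qed.

Lemma cfun_order_stat c (f : R -> R) n w t : (0 < n)%N -> 0 < t <= 1 ->
  cfun (fun n i => c n i * f (order_stat X n i w)) n t
  = cfun c n t * f (emp_quantile n w t).
Proof.
move=> n0 t01; have [i [_ _ _ cE]] := cfun_cell n0 t01.
by rewrite /emp_quantile !cE.
Qed.

(** Every order statistic fills a cell of length [1 / n], and sorting does not change a sum over the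
    sample. This is the empirical counterpart of [integral_quantile01]. *)
Lemma integral_emp_quantile (f : R -> R) n w : (0 < n)%N ->
  measurable_fun setT f -> (forall x, 0 <= f x) ->
  (\int[unif01]_t (f (emp_quantile n w t))%:E = (emp_mean f n w)%:E)%E.
Proof.
move=> n0 mf f0.
pose a n i := f (order_stat X n i w).
rewrite /emp_mean -(sum_order_stat X f n w) -(integral_unif01_cfun (a := a)) //; last first.
  by move=> i; exact: f0.
apply: eq_integral_unif01.
- apply/measurable_EFinP; apply: measurableT_comp => //.
  exact: measurable_emp_quantile.
- by move=> x; rewrite lee_fin.
- by apply/measurable_EFinP; exact: measurable_cfun.
- move=> x; rewrite lee_fin /cfun addr_ge0 //; first by case: ifP => //; rewrite f0.
  by apply: sumr_ge0 => i _; case: ifP => //; rewrite f0.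
move=> t /andP[t0 t1].
have t01 : 0 < t <= 1 by rewrite t0 ltW.
by have [i [_ _ _ cE]] := cfun_cell n0 t01; rewrite /emp_quantile !cE.
Qed.

Lemma emp_mean_count (p : pred R) n w :
  emp_mean (fun y => (p y)%:R) n w = (count p [seq X j w | j <- iota 0 n])%:R / n%:R.
Proof. by rewrite (count_indic X p) mulrC. Qed.

(** The empirical counterpart of [quantile_le]: for [t] in the cell of index [i], [t <= k / n] is
    equivalent to [i <= k]. *)
Lemma emp_quantile_le n w t x : (0 < n)%N -> 0 < t <= 1 ->
  (emp_quantile n w t <= x) = (t <= emp_mean (fun y => (y <= x)%R%:R) n w).
Proof.
move=> n0 t01; have [i [i_n it ti cE]] := cfun_cell n0 t01.
rewrite /emp_quantile cE order_stat_le // (@emp_mean_count (fun y => (y <= x)%R)).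
have n0R : 0 < n%:R^-1 :> R by rewrite invr_gt0 ltr0n.
set k := count _ _; apply/idP/idP => [ik|tk].
  by rewrite (le_trans ti) // ler_pM2r // ler_nat.
have := lt_le_trans it tk; rewrite ltr_pM2r // ltr_nat.
by case: i i_n {it ti cE} => // i _.
Qed.

Lemma emp_quantile_lt n w t x : (0 < n)%N -> 0 < t <= 1 ->
  (emp_quantile n w t < x) = (t <= emp_mean (fun y => (y < x)%R%:R) n w).
Proof.
move=> n0 t01; have [i [i_n it ti cE]] := cfun_cell n0 t01.
rewrite /emp_quantile cE order_stat_lt // (@emp_mean_count (fun y => (y < x)%R)).
have n0R : 0 < n%:R^-1 :> R by rewrite invr_gt0 ltr0n.
set k := count _ _; apply/idP/idP => [ik|tk].
  by rewrite (le_trans ti) // ler_pM2r // ler_nat.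
have := lt_le_trans it tk; rewrite ltr_pM2r // ltr_nat.
by case: i i_n {it ti cE} => // i _.
Qed.

(** A crude bound depending on [n], used only for integrability at fixed [n]. *)
Lemma cfun_bounded c n : exists B : R, 0 <= B /\ forall t : R, `|cfun c n t| <= B.
Proof.
exists (`|c n 1%N| + \sum_(1 <= i < n.+1) `|c n i|); split.
  by rewrite addr_ge0 // sumr_ge0.
move=> t; rewrite /cfun; apply: le_trans (ler_normD _ _) _; apply: lerD.
  by case: ifP; rewrite ?normr0.
apply: le_trans (ler_norm_sum _ _ _) _; apply: ler_sum => i _.
by case: ifP; rewrite ?normr0.
Qed.

Variables (h : R -> R) (c : nat -> nat -> R).
Hypothesis mh : measurable_fun setT h.
Hypothesis hi : P.-integrable setT (EFin \o (h \o X 0%N)).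
Let leb := @lebesgue_measure R.

Lemma integrable_quantile01 : leb.-integrable `]0, 1[ (EFin \o (h \o U)).
Proof.
have mU : measurable_fun setT U := measurable_quantile01 P mX.
have mhU : measurable_fun setT (h \o U) by exact: measurableT_comp.
apply/integrableP; split; first by apply/measurable_EFinP; exact: measurable_funTS.
rewrite -integral_unif01 //; last by apply: measurableT_comp => //; exact/measurable_EFinP.
rewrite (@integral_quantile01 _ _ _ P X mX (fun x => `|(h x)%:E|%E)) //.
  by case/integrableP : hi.
by apply: measurableT_comp => //; exact/measurable_EFinP.
Qed.

(** The common start for both conditions: the L-statistic is the integral of [c_n] times [h] of the
    empirical quantile, because each cell has length [1 / n], and the centering is the same integral
    with the true quantile. *)
Lemma Lstat_sub_le n w : (0 < n)%N ->
  ((`|Lstat X h c n w - Rintegral leb `[0, 1]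
      (fun t => cfun c n t * h (quantile (distr_fun P X) t))|)%:E
  <= \int[unif01]_t (`|cfun c n t| * `|h (emp_quantile n w t) - h (U t)|)%:E)%E.
Proof.
move=> n0; have mD : measurable (`]0, 1[%classic : set R) by exact: measurable_itv.
have mU : measurable_fun setT U := measurable_quantile01 P mX.
have mc := measurable_cfun c n.
have mV := measurable_emp_quantile n w.
have mhU : measurable_fun setT (h \o U) by exact: measurableT_comp.
have mhV : measurable_fun setT (h \o emp_quantile n w) by exact: measurableT_comp.
(* Dropping the endpoints allows [quantile] to be replaced by [quantile01]. *)
have muE : Rintegral leb `[0, 1] (fun t => cfun c n t * h (quantile (distr_fun P X) t))
    = Rintegral leb `]0, 1[ (fun t => cfun c n t * h (U t)).
  have E : {in `]0, 1[%classic, (fun t => cfun c n t * h (U t)) =1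
      (fun t => cfun c n t * h (quantile (distr_fun P X) t))}.
    by move=> t; rewrite inE /= in_itv /= /U /quantile01 => ->.
  rewrite /Rintegral integral_itv_bndoo.
    by congr fine; apply: eq_integral => t /E /= ->.
  apply/measurable_EFinP; apply: eq_measurable_fun E _.
  by apply: measurable_funTS; exact: measurable_funM.
have iU : leb.-integrable `]0, 1[ (EFin \o (fun t => cfun c n t * h (U t))).
  have [B [B0 cB]] := cfun_bounded c n.
  have iB := @integrableZl _ _ _ leb _ mD B _ integrable_quantile01.
  apply: (@le_integrable _ _ _ leb `]0, 1[%classic mD _
    (fun x => B%:E * (h (U x))%:E)%E); last exact: iB.
    by apply/measurable_EFinP/measurable_funTS; exact: measurable_funM.
  by move=> t _ /=; rewrite lee_fin !normrM ler_wpM2r // (le_trans (cB t)) // ler_norm.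
pose a n i := c n i * h (order_stat X n i w).
have [ia aE] := integrable_cfun a n0.
have aV t : t \in (`]0, 1[%classic : set R) -> cfun a n t = cfun c n t * h (emp_quantile n w t).
  rewrite inE /= in_itv /= => /andP[t0 t1].
  by rewrite -(cfun_order_stat c h) ?t0 ?ltW.
have iV : leb.-integrable `]0, 1[ (EFin \o (fun t => cfun c n t * h (emp_quantile n w t))).
  by apply: eq_integrable ia => // t /aV /= ->.
have -> : Lstat X h c n w = Rintegral leb `]0, 1[ (fun t => cfun c n t * h (emp_quantile n w t)).
  rewrite /Lstat -aE; exact: eq_Rintegral.
rewrite muE -RintegralB // EFin_normr_Rintegral //; last first.
  by have := @integrableB _ _ _ leb _ mD _ _ iV iU.
apply: le_trans (le_abse_integral _ _ _) _ => //.
  by apply/measurable_EFinP/measurable_funTS/measurable_funB; exact: measurable_funM.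
rewrite integral_unif01.
- rewrite le_eqVlt; apply/orP; left; apply/eqP; apply: eq_integral => t _ /=.
  by rewrite -mulrBr normrM.
- apply/measurable_EFinP/measurable_funM; first exact: measurableT_comp.
  by apply: measurableT_comp => //; exact: measurable_funB.
- by move=> t; rewrite lee_fin mulr_ge0.
Qed.

End EmpiricalQuantile.

(** * Convergence of the level sets *)

Section QuantileMismatch.
Context {d : measure_display} {T : measurableType d} {R : realType}.
Variables (P : probability T R) (X : nat -> T -> R).
Hypothesis mX : forall n, measurable_fun setT (X n).
Hypothesis statX : strictly_stationary P X.
Hypothesis ergX : ergodic_seq P X.
Let U := quantile01 P X.
Let V := emp_quantile X.
Let mU : measurable_fun setT U := measurable_quantile01 P mX.
Let mV n w : measurable_fun setT (V n w) := measurable_emp_quantile X n w.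

Definition mismatch (A : set R) n w : \bar R :=
  (\int[unif01]_t (`|\1_A (V n w t) - \1_A (U t)|)%:E)%E.

(** Almost sure convergence of [mismatch] to 0, written with [e] since the values are extended
    reals; the null set does not depend on [e]. *)
Definition tracked (A : set R) := {ae P, forall w, forall e : R, 0 < e ->
  \forall n \near \oo, (mismatch A n w <= e%:E)%E}.

Lemma measurable_mismatch (A : set R) n w : measurable A ->
  measurable_fun setT (fun t => (`|\1_A (V n w t) - \1_A (U t)| : R)).
Proof.
move=> mA; apply: measurableT_comp => //.
by apply: measurable_funB; apply: measurableT_comp => //; exact: measurable_indic.
Qed.

Lemma mismatchC (A : set R) n w : mismatch (~` A) n w = mismatch A n w.
Proof.
apply: eq_integral => t _; rewrite !indicE !in_setC; congr (_%:E).
by case: (_ \in A); case: (_ \in A); rewrite /= ?subrr ?sub0r ?subr0 ?normrN.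
Qed.

Lemma trackedC (A : set R) : tracked A -> tracked (~` A).
Proof.
rewrite /tracked; apply: filterS => w Aw e e0; apply: filterS (Aw e e0) => n.
by rewrite mismatchC.
Qed.

Lemma emp_mean_indic_cvg (B : set R) : measurable B ->
  {ae P, forall w, (fun n => emp_mean X \1_B n w) @ \oo --> fine (P (X 0%N @^-1` B))}.
Proof.
move=> mB.
have mXB : measurable (X 0%N @^-1` B) by rewrite -[X in measurable X]setTI; exact: mX.
have E : Rintegral P setT (fun z => \1_B (X 0%N z)) = fine (P (X 0%N @^-1` B)).
  rewrite /Rintegral; congr fine.
  transitivity (\int[P]_z (\1_(X 0%N @^-1` B) z)%:E)%E => //.
  by rewrite integral_indic // setIT.
rewrite -E; apply: (ergodic_average mX statX ergX).
  exact: measurable_indic.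
exact: (integrable_indic P mXB).
Qed.

(* For the half-line the two indicators differ exactly between the levels [F_n x] and [F x]. *)
Lemma tracked_initial x : tracked `]-oo, x].
Proof.
rewrite /tracked; apply: filterS (emp_mean_indic_cvg (measurable_itv `]-oo, x])) => w cv e e0.
have [N _ HN] := (cvgrPdist_le _ _).1 cv e e0.
exists N.+1 => // n /= Nn.
have n0 : (0 < n)%N by rewrite (leq_trans _ Nn).
have {HN} := HN n (ltnW Nn).
set a := emp_mean _ _ _ _; set b := fine _ => ab.
have bE : b = distr_fun P X x.
  by rewrite /b /distr_fun; congr (fine (P _)); apply/seteqP; split => y /=; rewrite in_itv.
have aE : a = emp_mean X (fun y => (y <= x)%R%:R) n w.
  congr (_ * _); apply: eq_bigr => j _; rewrite indicE; congr ((nat_of_bool _)%:R).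
  by apply/idP/idP; rewrite inE /= in_itv.
(* [hi - lo] is the distance between the empirical and the true distribution function at [x]. *)
pose lo := Num.min a b; pose hi := Num.max a b.
have lohi : lo <= hi by rewrite ge_min !le_max lexx.
apply: (@le_trans _ _ (\int[unif01]_t (\1_(`[lo, hi]%classic : set R) t)%:E)%E).
  apply: le_integral_unif01.
  - by apply/measurable_EFinP; exact: measurable_mismatch.
  - by move=> t; rewrite lee_fin.
  - by apply/measurable_EFinP.
  - by move=> t; rewrite lee_fin.
  move=> t /andP[t0 t1]; rewrite lee_fin !indicE.
  have t01 : 0 < t < 1 by rewrite t0.
  have -> : (V n w t \in `]-oo, x]%classic) = (t <= a).
    have t01' : 0 < t <= 1 by rewrite t0 ltW.
    rewrite aE -emp_quantile_le //.
    by apply/idP/idP; rewrite inE /= in_itv.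
  have -> : (U t \in `]-oo, x]%classic) = (t <= b).
    rewrite bE -quantile_le // -quantile01E //.
    by apply/idP/idP; rewrite inE /= in_itv.
  have -> : (t \in `[lo, hi]%classic) = (lo <= t <= hi).
    by apply/idP/idP; rewrite inE /= in_itv.
  rewrite /lo /hi ge_min le_max.
  by case: (leP t a) => ta; case: (leP t b) => tb; rewrite /= ?subrr ?normr0 ?ler0n //
    ?subr0 ?sub0r ?normrN ?normr1 ?(ltW ta) ?(ltW tb) ?orbT.
rewrite integral_unif01; [|exact/measurable_EFinP|by move=> t; rewrite lee_fin].
rewrite integral_indic //.
apply: (@le_trans _ _ (lebesgue_measure (`[lo, hi]%classic : set R))).
  by apply: le_measure; rewrite ?inE //; exact: measurableI.
rewrite /= lebesgue_measure_itv /= lte_fin; case: ifP => _; last by rewrite lee_fin ltW.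
rewrite -EFinB lee_fin; apply: le_trans ab.
by rewrite /lo /hi; case: (leP a b) => h; [exact: ler_norm|rewrite distrC ler_norm].
Qed.

(** If the union contains just one of two points, either one of the first [m] sets separates them or
    that point lies in the remainder [G]. The two quantile functions give [G] its empirical
    frequency and its probability. *)
Lemma mismatch_bigcup (F : nat -> set R) (m : nat) n w : (0 < n)%N ->
  (forall k, measurable (F k)) ->
  (mismatch (\bigcup_k F k) n w <= \sum_(k < m) mismatch (F k) n w +
    ((emp_mean X \1_(\bigcup_k F k `\` \bigcup_(k < m) F k) n w)%:E +
     P (X 0%N @^-1` (\bigcup_k F k `\` \bigcup_(k < m) F k))))%E.
Proof.
move=> n0 mF; set A := \bigcup_k F k; set G := _ `\` _.
have mA : measurable A by exact: bigcupT_measurable.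
have mG : measurable G by apply: measurableD => //; exact: bigcup_measurable.
have mXG : measurable (X 0%N @^-1` G) by rewrite -[X in measurable X]setTI; exact: mX.
have mI (B : set R) : measurable B -> measurable_fun setT (\1_B : R -> R).
  by move=> ?; exact: measurable_indic.
rewrite -(integral_emp_quantile X w n0 (mI _ mG)) //.
have -> : P (X 0%N @^-1` G) = (\int[unif01]_t (\1_G (U t))%:E)%E.
  rewrite (@integral_quantile01 _ _ _ P X mX (EFin \o \1_G)); last 2 first.
  - by apply/measurable_EFinP; exact: mI.
  - by move=> x; rewrite lee_fin.
  transitivity (\int[P]_z (\1_(X 0%N @^-1` G) z)%:E)%E => //.
  by rewrite integral_indic // setIT.
rewrite /mismatch -ge0_integral_sum; [|exact: measurableT| |]; last 2 first.
- by move=> k; apply/measurable_EFinP; exact: measurable_mismatch.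
- by move=> k t _; rewrite lee_fin.
have mGV : measurable_fun setT (fun t => \1_G (V n w t) : R).
  by apply: (measurableT_comp (mI _ mG)).
have mGU : measurable_fun setT (fun t => \1_G (U t) : R).
  by apply: (measurableT_comp (mI _ mG)).
rewrite -ge0_integralD; [|exact: measurableT| | | |]; last 4 first.
- by move=> t _; rewrite lee_fin.
- exact/measurable_EFinP.
- by move=> t _; rewrite lee_fin.
- exact/measurable_EFinP.
rewrite -ge0_integralD; [|exact: measurableT| | | |]; last 4 first.
- by move=> t _; apply: sume_ge0 => k _; rewrite lee_fin.
- apply: emeasurable_sum => k; apply/measurable_EFinP; exact: measurable_mismatch.
- by move=> t _; rewrite -EFinD lee_fin.
- by apply/measurable_EFinP/measurable_funD.
apply: ge0_le_integral => //.
- by apply/measurable_EFinP; exact: measurable_mismatch.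
- apply: emeasurable_funD.
    apply: emeasurable_sum => k; apply/measurable_EFinP; exact: measurable_mismatch.
  by apply/measurable_EFinP/measurable_funD.
move=> t _; rewrite sumEFin -!EFinD lee_fin.
have S0 : 0 <= \sum_(k < m) `|\1_(F k) (V n w t) - \1_(F k) (U t)| :> R.
  exact: sumr_ge0.
have key x y : A x -> ~ A y ->
    1 <= \sum_(k < m) `|\1_(F k) x - \1_(F k) y| + (\1_G x + \1_G y) :> R.
  move=> Ax nAy; have [[k /= km Fkx]|nGx] := pselect ((\bigcup_(k < m) F k) x).
    rewrite (bigD1 (Ordinal km)) //= (_ : `|_| = 1); last first.
      rewrite !indicE mem_set // memNset ?subr0 ?normr1 // => Fky.
      by apply: nAy; exists k.
    by rewrite -!addrA lerDl !addr_ge0 // sumr_ge0.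
  have -> : \1_G x = 1 :> R by rewrite indicE mem_set.
  by rewrite addrCA lerDl addr_ge0 ?sumr_ge0.
have in1 x : A x -> \1_A x = 1 :> R by move=> Ax; rewrite indicE mem_set.
have in0 x : ~ A x -> \1_A x = 0 :> R by move=> Ax; rewrite indicE memNset.
have [AV|nAV] := pselect (A (V n w t)); have [AU|nAU] := pselect (A (U t)).
- by rewrite (in1 _ AV) (in1 _ AU) subrr normr0 !addr_ge0.
- apply: le_trans (key _ _ AV nAU).
  by rewrite (in1 _ AV) (in0 _ nAU) subr0 normr1.
- rewrite distrC [X in _ <= _ + X]addrC (eq_bigr (fun k : 'I_m =>
    `|\1_(F k) (U t) - \1_(F k) (V n w t)|)); last by move=> k _; rewrite distrC.
  apply: le_trans (key _ _ AU nAV).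
  by rewrite (in1 _ AU) (in0 _ nAV) subr0 normr1.
- by rewrite (in0 _ nAV) (in0 _ nAU) subrr normr0 !addr_ge0.
Qed.

(** The remainders [G m] decrease to the empty set, so some [m] makes the probability small; by the
    strong law the empirical frequency is then eventually small too, and [m] sets are left. *)
Lemma tracked_bigcup (F : nat -> set R) : (forall k, measurable (F k)) ->
  (forall k, tracked (F k)) -> tracked (\bigcup_k F k).
Proof.
move=> mF tF; pose G m := \bigcup_k F k `\` \bigcup_(k < m) F k.
have mG m : measurable (G m).
  by apply: measurableD; [exact: bigcupT_measurable|exact: bigcup_measurable].
have mXG m : measurable (X 0%N @^-1` G m) by rewrite -[X in measurable X]setTI; exact: mX.
have Gcvg : (P (X 0%N @^-1` G m) @[m --> \oo] --> 0)%E.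
  rewrite -(measure0 P) -(_ : \bigcap_m (X 0%N @^-1` G m) = set0); last first.
    rewrite -subset0 => w Gw; have [[k _ Fk] _] := Gw 0%N I.
    by have [_] := Gw k.+1 I; apply; exists k => /=.
  apply: nonincreasing_cvg_mu => //.
  - by rewrite (le_lt_trans (probability_le1 _ _)) ?ltry.
  - exact: bigcapT_measurable.
  - move=> i j ij; apply/subsetPset => w [Aw nw]; split => // -[k /= ki Fk].
    by apply: nw; exists k => //=; exact: leq_trans ki ij.
(* Countably many almost sure events are intersected before [e], and hence [m], is chosen. *)
have allF := ae_foralln tF.
have allG := ae_foralln (fun m => emp_mean_indic_cvg (mG m)).
rewrite /tracked; apply: filterS2 allF allG => w Fw Gw e e0.
have sumF m : forall e' : R, 0 < e' ->
    \forall n \near \oo, (\sum_(k < m) mismatch (F k) n w <= e'%:E)%E.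
  elim: m => [|m IH] e' e'0.
    by apply: nearW => n; rewrite big_ord0 lee_fin ltW.
  have e'2 : 0 < e' / 2 by rewrite divr_gt0.
  apply: filterS2 (IH _ e'2) (Fw m _ e'2) => n ? ?.
  by rewrite big_ord_recr /= [e']splitr EFinD leeD.
(* Probability at most [e / 8] and frequency at most [e / 4] stay below [e / 2] together. *)
have e8 : 0 < e / 8 by rewrite divr_gt0.
have [m Pm] : exists m, fine (P (X 0%N @^-1` G m)) <= e / 8.
  move/fine_cvgP: Gcvg => [_ /cvgrPdist_le /(_ _ e8) [m _ Hm]]; exists m.
  by have := Hm m (leqnn m); rewrite /= sub0r normrN; apply: le_trans; exact: ler_norm.
have e2 : 0 < e / 2 by rewrite divr_gt0.
have /cvgrPdist_le /(_ (e / 8) e8) Gm := Gw m.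
apply: filterS3 (sumF m _ e2) Gm (nbhs_infty_gt 0) => n Sn Gn n0.
apply: le_trans (mismatch_bigcup m w n0 mF) _; rewrite -/(G m).
rewrite [e]splitr EFinD leeD // -[P _]fineK ?fin_num_measure // -EFinD lee_fin.
by move: Gn Pm; rewrite ler_distl => /andP[]; lra.
Qed.

(** Dynkin's pi-lambda theorem; the generating half-lines are complements of those in
    [tracked_initial]. *)
Theorem trackedP (A : set R) : measurable A -> tracked A.
Proof.
have E : @measurable _ R = <<s (@RGenOInfty.G R) >> := RGenOInfty.measurableE R.
rewrite E; apply: (@dynkin_induction _ _ (@RGenOInfty.G R)).
- exact: E.
- move=> _ _ [x ->] [y ->]; exists (Num.max x y).
  by apply/seteqP; split => z /=; rewrite !in_itv /= !andbT gt_max;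
    [case=> -> ->|move/andP].
- rewrite -setC0; apply: trackedC; rewrite /tracked; apply: aeW => w e e0; apply: nearW => n.
  rewrite /mismatch integral0_eq ?lee_fin ?ltW // => t _.
  by rewrite !indicE !in_set0 subrr normr0.
- by move=> _ [x ->]; rewrite -setCitvl; apply: trackedC; exact: tracked_initial.
- by move=> S _; exact: trackedC.
- by move=> F mF _; exact: tracked_bigcup.
Qed.

End QuantileMismatch.

(** * Condition (ii) *)

Section SimpleApproximation.
Import HBNNSimple.
Context {d : measure_display} {T : measurableType d} {R : realType}.

Lemma nonneg_simple_approximation (f : T -> R) : measurable_fun setT f ->
  (forall x, 0 <= f x) -> exists g : nat -> T -> R,
  [/\ forall k, measurable_fun setT (g k), forall k, finite_set (range (g k)),
      forall k x, 0 <= g k x <= f x & forall x, g^~ x @ \oo --> f x].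
Proof.
move=> mf f0.
have mEf : measurable_fun setT (EFin \o f) by exact/measurable_EFinP.
pose g := nnsfun_approx measurableT mEf.
have gnd : nondecreasing_seq (g : (T -> R)^nat) := nd_nnsfun_approx measurableT mEf.
have gcvg := cvg_nnsfun_approx measurableT mEf (fun x _ => f0 x).
have gc (x : T) : (fun k => g k x) @ \oo --> f x by apply: fine_cvg (gcvg x I).
exists (fun k => g k : T -> R); split => //.
move=> k x; rewrite fun_ge0 /= -(cvg_lim _ (gc x)) //.
apply: nondecreasing_cvgn_le; last by apply/cvg_ex; exists (f x); exact: gc.
by move=> i j /gnd /lefP.
Qed.

(** Positive and negative parts are approximated from below. At each point one of them vanishes
    together with its approximation, which gives the bound by [|f x|] needed later for
    domination. *)
Lemma simple_approximation (f : T -> R) : measurable_fun setT f ->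
  exists s : nat -> T -> R,
  [/\ forall k, measurable_fun setT (s k), forall k, finite_set (range (s k)),
      forall k x, `|f x - s k x| <= `|f x| & forall x, s^~ x @ \oo --> f x].
Proof.
move=> mf.
have [|x|g [mg fg g0 cg]] := @nonneg_simple_approximation (fun x => Num.max (f x) 0).
- by apply: measurable_maxr.
- by rewrite le_max lexx orbT.
have [|x|g' [mg' fg' g0' cg']] := @nonneg_simple_approximation (fun x => Num.max (- f x) 0).
- by apply: measurable_maxr => //; exact: measurable_funN.
- by rewrite le_max lexx orbT.
exists (fun k x => g k x - g' k x); split => [k|k|k x|x].
- exact: measurable_funB.
- by apply: (finite_image11 (fun x y => x - y)).
- have := g0 k x; have := g0' k x.
  have [f0|f0] := leP 0 (f x).
    by rewrite (max_idPr _) ?oppr_le0 // => g'0 gf; rewrite !ger0_norm //; lra.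
  have fN : 0 <= - f x by rewrite oppr_ge0 ltW.
  rewrite (max_idPl fN) => g'0 gf.
  by rewrite ler0_norm ?ltr0_norm //; lra.
have -> : f x = Num.max (f x) 0 - Num.max (- f x) 0.
  have [f0|f0] := leP 0 (f x).
    by rewrite (max_idPr _) ?oppr_le0 // subr0.
  have fN : 0 <= - f x by rewrite oppr_ge0 ltW.
  by rewrite (max_idPl fN) opprK add0r.
exact: cvgB.
Qed.

End SimpleApproximation.

(* [wt] is [0] when [p = 1] and [|c n i|^q] otherwise. *)
Lemma Young_weight (R : realType) (c : nat -> nat -> R) (p : R) : 1 <= p ->
  (if p == 1 then exists M, forall n, (0 < n)%N -> Cinf c n <= M
   else exists M, forall n, (0 < n)%N -> Cq c n (p / (p - 1)) <= M) ->
  exists (wt : nat -> nat -> R) (M : R), [/\ forall n i, 0 <= wt n i,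
    forall n, (0 < n)%N -> n%:R^-1 * \sum_(1 <= i < n.+1) wt n i <= M &
    forall delta, 0 < delta -> exists2 K, 0 <= K & forall n i y, (0 < i <= n)%N ->
      0 <= y -> `|c n i| * y <= delta * wt n i + K * y `^ p].
Proof.
move=> p1; have [->|pn1] := eqVneq p 1 => -[M HM].
  exists (fun _ _ => 0), 0; split => //.
    by move=> n _; rewrite big1 ?mulr0.
  move=> delta delta0; exists `|M| => // n i y /andP[i0 i_n] y0.
  rewrite mulr0 add0r powRr1 // ler_wpM2r //.
  have n0 : (0 < n)%N := leq_trans i0 i_n.
  apply: le_trans (ler_norm M); apply: le_trans (HM n n0); rewrite /Cinf.
  by apply: (le_bigmax_seq _ i) => //; rewrite mem_index_iota i0.

have {}p1 : 1 < p by rewrite lt_neqAle eq_sym pn1.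
have pm1 : 0 < p - 1 by rewrite subr_gt0.
have p0 : 0 < p by rewrite (lt_trans ltr01).
set q := p / (p - 1); have q0 : 0 < q by rewrite divr_gt0.
have q1 : 1 <= q by rewrite ler_pdivlMr // mul1r gerBl.
have pq : q^-1 + p^-1 = 1.
  by rewrite /q invf_div; field; rewrite !gt_eqF.
exists (fun n i => `|c n i| `^ q), M; split; [by move=> n i; exact: powR_ge0|exact: HM|].
(* Young's inequality is applied to [s * |c n i|] and [s^-1 * y]. As [s] to the power [q] is
   [delta], the weight gets the factor [delta], and the constant is [s^-1] to the power [p]; the
   divisions by [q] and [p] are dropped. *)
move=> delta delta0; pose s := delta `^ q^-1.
have s0 : 0 < s by exact: powR_gt0.
exists ((s^-1) `^ p) => [|n i y _ y0]; first exact: powR_ge0.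
have -> : `|c n i| * y = (s * `|c n i|) * (s^-1 * y).
  by rewrite mulrACA mulfV ?mul1r ?gt_eqF.
have s00 := ltW s0; have delta00 := ltW delta0; have sV0 : 0 <= s^-1 by rewrite invr_ge0.
have := @conjugate_powR R (s * `|c n i|) (s^-1 * y) q p.
rewrite !mulr_ge0 // => /(_ isT isT q0 p0 pq) H.
apply: le_trans H _; apply: lerD.
  rewrite powRM // /s -powRrM mulVf ?gt_eqF // powRr1 //.
  by rewrite ler_pdivrMr // ler_peMr // mulr_ge0 ?powR_ge0.
rewrite powRM //.
by rewrite ler_pdivrMr // ler_peMr ?(ltW p1) // mulr_ge0 ?powR_ge0.
Qed.

Section IntegralUnif01.
Context {R : realType}.
Implicit Types f g : R -> R.

Lemma unif01D f g : measurable_fun setT f -> (forall t, 0 <= f t) ->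
  measurable_fun setT g -> (forall t, 0 <= g t) ->
  (\int[unif01]_t (f t + g t)%:E = \int[unif01]_t (f t)%:E + \int[unif01]_t (g t)%:E)%E.
Proof.
move=> mf f0 mg g0; rewrite -ge0_integralD //; try exact/measurable_EFinP.
- by move=> t _; rewrite lee_fin.
- by move=> t _; rewrite lee_fin.
Qed.

Lemma unif01Z K f : 0 <= K -> measurable_fun setT f -> (forall t, 0 <= f t) ->
  (\int[unif01]_t (K * f t)%:E = K%:E * \int[unif01]_t (f t)%:E)%E.
Proof.
move=> K0 mf f0; rewrite -ge0_integralZl //; try exact/measurable_EFinP.
by move=> t _; rewrite lee_fin.
Qed.

Lemma unif01_sum (I : Type) (r : seq I) (F : I -> R -> R) :
  (forall i, measurable_fun setT (F i)) -> (forall i t, 0 <= F i t) ->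
  (\int[unif01]_t (\sum_(i <- r) F i t)%:E = \sum_(i <- r) \int[unif01]_t (F i t)%:E)%E.
Proof.
move=> mF F0; under eq_integral do rewrite -sumEFin.
rewrite ge0_integral_sum; [by []|exact: measurableT| |].
- by move=> i; apply/measurable_EFinP; exact: mF.
- by move=> i t _; rewrite lee_fin.
Qed.

End IntegralUnif01.

(** * Splitting the error by a simple function *)

Section LpCondition.
Context {d : measure_display} {T : measurableType d} {R : realType}.
Variables (P : probability T R) (X : nat -> T -> R).
Hypothesis mX : forall n, measurable_fun setT (X n).
Variables (h : R -> R) (c : nat -> nat -> R) (p : R).
Hypothesis mh : measurable_fun setT h.
Hypothesis p1 : 1 <= p.
Let U := quantile01 P X.
Let V := emp_quantile X.
Let mU : measurable_fun setT U := measurable_quantile01 P mX.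
Let mV n w : measurable_fun setT (V n w) := measurable_emp_quantile X n w.
Let p0 : 0 < p. Proof. exact: lt_le_trans ltr01 p1. Qed.

Variables (s : R -> R) (rs : seq R).
Hypothesis ms : measurable_fun setT s.
Hypothesis srs : range s = [set` rs].

(** Bounds the [p]-th power of any difference of two values of [s]. *)
Let B : R := (2 * \sum_(r <- rs) `|r|) `^ p.

Let mem_rs x : s x \in rs.
Proof. by have : range s (s x) by []; rewrite srs. Qed.

Let norm_s x : `|s x| <= \sum_(r <- rs) `|r|.
Proof.
by rewrite (big_rem (s x)) ?mem_rs //= lerDl sumr_ge0.
Qed.

(** If [s u] and [s v] differ, the level set of the value [s u] contains [u] but not [v], so the sum
    is at least 1. *)
Lemma simple_mismatch u v : `|s u - s v| `^ p <=
  B * \sum_(r <- rs) `|\1_(s @^-1` [set r]) u - \1_(s @^-1` [set r]) v|.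
Proof.
have [->|suv] := eqVneq (s u) (s v).
  by rewrite subrr normr0 powR0 ?gt_eqF // mulr_ge0 ?powR_ge0 ?sumr_ge0.
apply: (@le_trans _ _ B).
  apply: ge0_ler_powR; rewrite ?nnegrE ?mulr_ge0 ?sumr_ge0 ?(ltW p0) //.
  by rewrite (le_trans (ler_normB _ _)) // mulr_natl mulr2n lerD ?norm_s.
rewrite ler_peMr ?powR_ge0 // (big_rem (s u)) ?mem_rs //=.
rewrite (_ : `|_| = 1) ?lerDl ?sumr_ge0 //.
rewrite !indicE mem_set // memNset ?subr0 ?normr1 //= => E.
by rewrite E eqxx in suv.
Qed.

(** [h u - h v] is split through [s u] and [s v], and the weighted inequality is used on each of the
    three pieces, hence [3 * delta]. The outer pieces integrate to an empirical and a true mean;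
    [simple_mismatch] handles the middle one. *)
Lemma simple_bound (wt : nat -> nat -> R) (M delta K : R) n w :
  (forall n i, 0 <= wt n i) -> n%:R^-1 * \sum_(1 <= i < n.+1) wt n i <= M ->
  0 < delta -> 0 <= K ->
  (forall n i y, (0 < i <= n)%N -> 0 <= y ->
     `|c n i| * y <= delta * wt n i + K * y `^ p) -> (0 < n)%N ->
  P.-integrable setT (EFin \o ((fun x => `|h x - s x| `^ p) \o X 0%N)) ->
  (\int[unif01]_t (`|cfun c n t| * `|h (V n w t) - h (U t)|)%:E <=
   (3 * delta * M)%:E + K%:E * ((emp_mean X (fun x => (`|h x - s x| `^ p)%R) n w)%:E +
     (\int[P]_z (`|h (X 0%N z) - s (X 0%N z)| `^ p))%:E
      + B%:E * \sum_(r <- rs) mismatch P X (s @^-1` [set r]) n w))%E.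
Proof.
move=> wt0 wtM d0 K0 cK n0 gi.
pose g x := `|h x - s x| `^ p.
have mg : measurable_fun setT g.
  apply: (measurableT_comp (measurable_powR _)); apply: measurableT_comp => //.
  exact: measurable_funB.
have g0 x : 0 <= g x by exact: powR_ge0.
pose m r t : R := `|\1_(s @^-1` [set r]) (V n w t) - \1_(s @^-1` [set r]) (U t)|.
have msr r : measurable (s @^-1` [set r]).
  by rewrite -[X in measurable X]setTI; apply: ms => //; exact: measurable_set1.
have mm r : measurable_fun setT (m r) by exact: measurable_mismatch.
have m0 r t : 0 <= m r t by exact: normr_ge0.
have mgV : measurable_fun setT (fun t => g (V n w t)) by exact: measurableT_comp.
have mgU : measurable_fun setT (fun t => g (U t)) by exact: measurableT_comp.
have mS : measurable_fun setT (fun t => \sum_(r <- rs) m r t) by exact: measurable_sum.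
have S0 t : 0 <= \sum_(r <- rs) m r t by exact: sumr_ge0.
have B0 : 0 <= B by exact: powR_ge0.
have mBS : measurable_fun setT (fun t => B * \sum_(r <- rs) m r t).
  by apply: measurable_funM.
have mgg : measurable_fun setT (fun t => g (V n w t) + g (U t)).
  exact: measurable_funD.
have mG : measurable_fun setT
    (fun t => g (V n w t) + g (U t) + B * \sum_(r <- rs) m r t).
  exact: measurable_funD.
have gg0 t : 0 <= g (V n w t) + g (U t) by rewrite addr_ge0.
have BS0 t : 0 <= B * \sum_(r <- rs) m r t by rewrite mulr_ge0.
have G0 t : 0 <= g (V n w t) + g (U t) + B * \sum_(r <- rs) m r t by rewrite addr_ge0.
have mKG := measurable_funM (measurable_cst K) mG.
have mwt := measurable_cfun wt n.
have wtc0 t : 0 <= cfun wt n t.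
  rewrite /cfun addr_ge0 //; first by case: ifP.
  by apply: sumr_ge0 => i _; case: ifP.
have d30 : 0 <= 3 * delta by rewrite mulr_ge0 // ltW.
have mL : measurable_fun setT (fun t => `|cfun c n t| * `|h (V n w t) - h (U t)|).
  apply: measurable_funM; first by apply: measurableT_comp => //; exact: measurable_cfun.
  by apply: measurableT_comp => //; apply: measurable_funB; exact: measurableT_comp.
apply: (@le_trans _ _ (\int[unif01]_t
   (3 * delta * cfun wt n t + K * (g (V n w t) + g (U t) + B * \sum_(r <- rs) m r t))%:E)%E).
  apply: le_integral_unif01.
  - exact/measurable_EFinP.
  - by move=> t; rewrite lee_fin mulr_ge0.
  - apply/measurable_EFinP; apply: measurable_funD; first exact: measurable_funM.
    exact: mKG.
  - by move=> t; rewrite lee_fin addr_ge0 // mulr_ge0.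
  move=> t /andP[t0 t1]; rewrite lee_fin.
  have t01 : 0 < t <= 1 by rewrite t0 ltW.
  have [i [i_n _ _ cE]] := cfun_cell n0 t01; rewrite !cE.
  set u := V n w t; set v := U t.
  apply: (@le_trans _ _ (`|c n i| * `|h u - s u| + `|c n i| * `|s u - s v| +
    `|c n i| * `|h v - s v|)).
    rewrite -!mulrDr ler_wpM2l //.
    have -> : h u - h v = (h u - s u) + (s u - s v) - (h v - s v) by ring.
    by apply: le_trans (ler_normB _ _) _; rewrite lerD2r ler_normD.
  have H1 := cK n i _ i_n (normr_ge0 (h u - s u)).
  have H2 := cK n i _ i_n (normr_ge0 (s u - s v)).
  have H3 := cK n i _ i_n (normr_ge0 (h v - s v)).
  have H4 : K * `|s u - s v| `^ p <= K * (B * \sum_(r <- rs) m r t).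
    by rewrite ler_wpM2l // simple_mismatch.
  have -> : K * (g u + g v + B * \sum_(r <- rs) m r t) =
      K * `|h u - s u| `^ p + K * `|h v - s v| `^ p + K * (B * \sum_(r <- rs) m r t).
    by rewrite /g !mulrDr.
  rewrite -[3 * delta * _]mulrA.
  move: H1 H2 H3 H4.
  move: (K * (B * _)) (K * `|h u - s u| `^ p) (K * `|h v - s v| `^ p) (K * `|s u - s v| `^ p).
  move: (delta * wt n i) (`|c n i| * `|h u - s u|) (`|c n i| * `|s u - s v|)
    (`|c n i| * `|h v - s v|) => ? ? ? ? ? ? ? ?; lra.
have mdw := measurable_funM (measurable_cst (3 * delta)) mwt.
rewrite (unif01D mdw) //; last 2 first.
- by move=> t; rewrite mulr_ge0.
- by move=> t; rewrite mulr_ge0.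
rewrite unif01Z // integral_unif01_cfun // unif01Z // unif01D //.
rewrite unif01D // unif01Z // unif01_sum // integral_emp_quantile //.
rewrite (@integral_quantile01 _ _ _ P X mX (EFin \o g)); last 2 first.
- exact/measurable_EFinP.
- by move=> x; rewrite lee_fin.
apply: leeD; first by rewrite -EFinM lee_fin ler_wpM2l.
rewrite lee_wpmul2l ?lee_fin //.
rewrite /Rintegral fineK //.
exact: (integrable_fin_num measurableT gi).
Qed.

End LpCondition.

(** * Almost sure convergence under the moment condition *)

Section LpTheorem.
Context {d : measure_display} {T : measurableType d} {R : realType}.
Variables (P : probability T R) (X : nat -> T -> R).
Hypothesis mX : forall n, measurable_fun setT (X n).
Hypothesis statX : strictly_stationary P X.
Hypothesis ergX : ergodic_seq P X.
Variables (h : R -> R) (c : nat -> nat -> R).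
Hypothesis mh : measurable_fun setT h.

Definition Lmean n : R := Rintegral lebesgue_measure `[0, 1]
  (fun t => cfun c n t * h (quantile (distr_fun P X) t)).

Variable p : R.
Hypothesis p1 : 1 <= p.
Hypothesis hp : (\int[P]_w ((`|h (X 0%N w)| `^ p)%:E) < +oo)%E.

Let mhX : measurable_fun setT (h \o X 0%N).
Proof. exact: measurableT_comp. Qed.

Let p0 : 0 < p. Proof. exact: lt_le_trans ltr01 p1. Qed.

Let measurable_powR_norm d' (S : measurableType d') (f : S -> R) :
  measurable_fun setT f -> measurable_fun setT (fun x => `|f x| `^ p).
Proof.
by move=> mf; apply: (measurableT_comp (measurable_powR _)); exact: measurableT_comp.
Qed.

Lemma integrable_powR : P.-integrable setT (EFin \o (fun w => `|h (X 0%N w)| `^ p)).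
Proof.
apply/integrableP; split; first by apply/measurable_EFinP; exact: measurable_powR_norm.
under eq_integral do rewrite /= ger0_norm ?powR_ge0 //.
exact: hp.
Qed.

(** On a probability space it suffices that [|h| <= 1 + |h|^p]. *)
Lemma integrable_of_powR : P.-integrable setT (EFin \o (h \o X 0%N)).
Proof.
have i1 := finite_measure_integrable_cst P 1 measurableT.
have iD := @integrableD _ _ _ P _ measurableT _ _ i1 integrable_powR.
apply: (@le_integrable _ _ _ P setT measurableT _
  (fun w => (1 + `|h (X 0%N w)| `^ p)%:E)); last exact: iD.
  by apply/measurable_EFinP; exact: measurableT_comp.
move=> w _; rewrite /= lee_fin [leRHS]ger0_norm ?addr_ge0 ?powR_ge0 //.
have [h1|h1] := leP `|h (X 0%N w)| 1.
  by rewrite (le_trans h1) // lerDl powR_ge0.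
by rewrite (le_trans (le1r_powR (ltW h1) p1)) // lerDr.
Qed.

Lemma powR_dist_cvg0 (s : nat -> R) (l : R) : s @ \oo --> l ->
  (fun k => `|l - s k| `^ p) @ \oo --> 0.
Proof.
move=> sl; apply/cvgrPdist_le => e e0.
(* Below 1 a [p]-th power with [1 <= p] does not exceed its base. *)
have m0 : 0 < Num.min e 1 by rewrite lt_min e0 ltr01.
apply: filterS ((cvgrPdist_le _ _).1 sl _ m0) => k /=.
rewrite le_min => /andP[ke k1].
rewrite sub0r normrN ger0_norm ?powR_ge0 //.
have [->|kn0] := eqVneq `|l - s k| 0; first by rewrite powR0 ?gt_eqF // ltW.
apply: le_trans ke; apply: ge1r_powR => //.
by rewrite k1 andbT lt_neqAle eq_sym kn0 normr_ge0.
Qed.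

(** The order of choices is [delta] from [M], then [K] from [delta], then the simple function [s k]
    from [K], then the tolerance [eta] for its level sets, and [n] last. *)
Theorem Lstat_cvg_Lp :
  (if p == 1 then exists M, forall n, (0 < n)%N -> Cinf c n <= M
   else exists M, forall n, (0 < n)%N -> Cq c n (p / (p - 1)) <= M) ->
  {ae P, forall w, (fun n => Lstat X h c n w - Lmean n) @ \oo --> 0}.
Proof.
move=> /(Young_weight p1)[wt [M [wt0 wtM cK]]].
have [s [ms fs sh scvg]] := simple_approximation mh.
have /choice[rs rsE] : forall k, exists r : seq R, range (s k) = [set` r].
  by move=> k; apply/finite_seqP.
pose g k x := `|h x - s k x| `^ p.
have mg k : measurable_fun setT (g k).
  by apply: measurable_powR_norm; exact: measurable_funB.
have mgX k : measurable_fun setT (g k \o X 0%N) by exact: measurableT_comp.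
have g_le k x : g k x <= `|h x| `^ p.
  by apply: ge0_ler_powR; rewrite ?nnegrE ?(ltW p0) ?normr_ge0 // sh.
have gi k : P.-integrable setT (EFin \o (g k \o X 0%N)).
  apply: (@le_integrable _ _ _ P setT measurableT _ _ _ _ integrable_powR).
    exact/measurable_EFinP.
  by move=> w _; rewrite /= lee_fin [leLHS]ger0_norm ?[leRHS]ger0_norm ?powR_ge0 // g_le.
pose E k := \int[P]_z g k (X 0%N z).
have E0 : E @ \oo --> 0.
  have [] := @dominated_convergence _ _ _ P setT measurableT
    (fun k => EFin \o (g k \o X 0%N)) (cst 0%E)
    (EFin \o (fun w => `|h (X 0%N w)| `^ p)).
  - by move=> k; exact/measurable_EFinP.
  - exact: measurable_cst.
  - apply: aeW => w _; apply: cvg_EFin; first exact: nearW.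
    exact: powR_dist_cvg0.
  - exact: integrable_powR.
  - by apply: aeW => w k _; rewrite /= lee_fin [leLHS]ger0_norm ?powR_ge0 // g_le.
  by move=> _ _; rewrite integral0 => /fine_cvg.
have gcvg := ae_foralln (fun k => ergodic_average mX statX ergX (mg k) (gi k)).
have mlev k r : measurable (s k @^-1` [set r]).
  by rewrite -[X in measurable X]setTI; apply: ms => //; exact: measurable_set1.
(* Values are indexed by naturals to keep the intersection countable; past the end of the list the
   default 0 still names a measurable level set. *)
have trk := ae_foralln (fun k => ae_foralln (fun i =>
  trackedP mX statX ergX (mlev k (nth 0 (rs k) i)))).
apply: filterS2 gcvg trk => w gw tw; apply/cvgrPdist_le => e e0.
pose delta := e / (12 * (`|M| + 1)).
have M1 : 0 < `|M| + 1 by rewrite ltr_wpDl.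
have d0 : 0 < delta by rewrite divr_gt0 // mulr_gt0.
have dM : 3 * delta * M <= e / 4.
  apply: (@le_trans _ _ (3 * delta * (`|M| + 1))).
    apply: ler_wpM2l; first by rewrite mulr_ge0 // ltW.
    by rewrite (le_trans (ler_norm M)) // lerDl.
  rewrite /delta le_eqVlt; apply/orP; left; apply/eqP; field.
  by rewrite gt_eqF.
have [K K0 cKd] := cK delta d0.
have K1 : 0 < K + 1 by rewrite ltr_wpDl.
(* The factor of [K] will be at most [2 * e' + e' + e'], for the empirical mean, the true mean and
   the level sets. This contributes at most [e / 4], like the [delta] term. *)
pose e' := e / (16 * (K + 1)).
have e'0 : 0 < e' by rewrite divr_gt0 // mulr_gt0.
have Ke : K * e' <= e / 16.
  apply: (@le_trans _ _ ((K + 1) * e')); first by rewrite ler_wpM2r ?(ltW e'0) // lerDl.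
  rewrite /e' le_eqVlt; apply/orP; left; apply/eqP; field.
  by rewrite gt_eqF.
have [k Ek] : exists k, E k <= e'.
  have [k _ Hk] := (cvgrPdist_le _ _).1 E0 _ e'0; exists k.
  by have := Hk k (leqnn k); rewrite /= sub0r normrN; apply: le_trans; exact: ler_norm.
pose B : R := (2 * \sum_(r <- rs k) `|r|) `^ p.
have B0 : 0 <= B by exact: powR_ge0.
have B1 : 0 < B + 1 by rewrite ltr_wpDl.
have mis : forall eta : R, 0 < eta -> \forall n \near \oo,
    (\sum_(r <- rs k) mismatch P X (s k @^-1` [set r]) n w <= eta%:E)%E.
  have : forall r, r \in rs k -> forall eta : R, 0 < eta -> \forall n \near \oo,
      (mismatch P X (s k @^-1` [set r]) n w <= eta%:E)%E.
    by move=> r rk; have := tw k (index r (rs k)); rewrite nth_index.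
  elim: (rs k) => [|r l IH] H eta eta0.
    by apply: nearW => n; rewrite big_nil lee_fin ltW.
  have eta2 : 0 < eta / 2 by rewrite divr_gt0.
  have Hl r' : r' \in l -> forall eta : R, 0 < eta -> \forall n \near \oo,
      (mismatch P X (s k @^-1` [set r']) n w <= eta%:E)%E.
    by move=> r'l; apply: H; rewrite inE r'l orbT.
  apply: filterS2 (H r (mem_head _ _) _ eta2) (IH Hl _ eta2) => n ? ?.
  by rewrite big_cons [eta]splitr EFinD leeD.
pose eta := e' / (B + 1).
have eta0 : 0 < eta by rewrite divr_gt0.
have Beta : B * eta <= e'.
  apply: (@le_trans _ _ ((B + 1) * eta)); first by rewrite ler_wpM2r ?(ltW eta0) // lerDl.
  rewrite /eta le_eqVlt; apply/orP; left; apply/eqP; field.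
  by rewrite gt_eqF.
have gk : \forall n \near \oo, `|E k - emp_mean X (g k) n w| <= e'.
  exact: (cvgrPdist_le _ _).1 (gw k) _ e'0.
apply: filterS3 gk (mis _ eta0) (nbhs_infty_gt 0) => n /= gn mn n0.
rewrite sub0r normrN -lee_fin.
apply: le_trans (Lstat_sub_le mX c mh integrable_of_powR w n0) _.
apply: le_trans (simple_bound mX mh p1 (ms k) (rsE k) w wt0 (wtM n n0) d0 K0 cKd n0 (gi k)) _.
apply: (@le_trans _ _ ((3 * delta * M)%:E +
  K%:E * ((emp_mean X (g k) n w)%:E + (E k)%:E + B%:E * eta%:E)))%E.
  by rewrite leeD2l // lee_wpmul2l ?lee_fin // leeD2l // lee_wpmul2l ?lee_fin.
rewrite -!(EFinM, EFinD) lee_fin.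
have emp : emp_mean X (g k) n w <= 2 * e'.
  move: gn Ek; rewrite ler_distl -/(E k) -/(emp_mean X (g k) n w) => /andP[]; lra.
have : K * (emp_mean X (g k) n w + E k + B * eta) <= K * (4 * e').
  by rewrite ler_wpM2l //; move: emp Ek Beta; lra.
move: dM Ke e0; rewrite [K * (4 * _)]mulrCA.
move: (K * (_ + _)) (K * e') (3 * delta * M) => ? ? ?; lra.
Qed.

End LpTheorem.

(** * Condition (i) *)

(** Heine-Cantor: the compact interval is nearly covered along the filter of small positive
    [delta]. *)
Lemma within_continuous_unif01 (R : realType) (G : R -> R) :
  {within `[0, 1], continuous G} -> forall e : R, 0 < e ->
  exists2 delta : R, 0 < delta & forall x y, 0 <= x <= 1 -> 0 <= y <= 1 ->
    `|x - y| <= delta -> `|G x - G y| <= e.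
Proof.
move=> /subspace_continuousP cG e e0.
pose K : set R := `[0, 1]%classic.
have in01 x : K x = (0 <= x <= 1) :> Prop by rewrite /K /= in_itv.
have e2 : 0 < e / 2 by rewrite divr_gt0.
have /compact_near_coveringP cK : compact K by exact: segment_compact.
have := cK R (0^'+) (fun delta x =>
  K x -> forall y, K y -> `|x - y| <= delta -> `|G x - G y| <= e) _.
case=> [x Kx|delta /= delta0 H].
  have nx : \forall t \near x, K t -> `|G x - G t| < e / 2.
    exact: (cvgrPdist_lt _ _).1 (cG x Kx) _ e2.
  have [r /= r0 Hr] := (nbhs_ballP _ _).1 nx.
  (* One half of [r] is for the move from [x] to [x'], the other for [delta], so [x'] and [y] both
     stay within [r] of [x]. *)
  have r2 : 0 < r / 2 by rewrite divr_gt0.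
  exists (ball x (r / 2), [set delta : R | delta < r / 2]).
    split; first exact: nbhsx_ballx.
    exists (r / 2) => //= delta; rewrite /ball_ /= sub0r normrN => dr _.
    exact: le_lt_trans (ler_norm _) dr.
  move=> [x' delta] /= [xx' dr] Kx' y Ky x'y.
  have h1 : `|G x - G x'| < e / 2.
    by apply: Hr => //; move: xx'; rewrite /ball /= => xx'; apply: (lt_trans xx'); lra.
  have h2 : `|G x - G y| < e / 2.
    apply: Hr => //; rewrite /ball /=.
    have -> : x - y = (x - x') + (x' - y) by ring.
    apply: le_lt_trans (ler_normD _ _) _; move: xx'; rewrite /ball /= => xx'.
    by move: x'y; lra.
  have -> : G x' - G y = (G x - G y) - (G x - G x') by ring.
  by apply: le_trans (ler_normB _ _) _; lra.
exists (delta / 2); first by rewrite divr_gt0.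
move=> x y x01 y01 xy.
have dd : ball_ Num.norm 0 delta (delta / 2).
  by rewrite /ball_ /= sub0r normrN ger0_norm ?divr_ge0 ?ltW //; lra.
by apply: (H (delta / 2) dd _ x) => //; rewrite ?in01 // divr_gt0.
Qed.

Section ContinuousCondition.
Context {d : measure_display} {T : measurableType d} {R : realType}.
Variables (P : probability T R) (X : nat -> T -> R).
Hypothesis mX : forall n, measurable_fun setT (X n).
Hypothesis statX : strictly_stationary P X.
Variable h : R -> R.
Hypothesis mh : measurable_fun setT h.
Let F := distr_fun P X.
Let Q := quantile F.
Let U := quantile01 P X.
Let V := emp_quantile X.
Let mU : measurable_fun setT U := measurable_quantile01 P mX.
Let mV n w : measurable_fun setT (V n w) := measurable_emp_quantile X n w.
Variable G : R -> R.
Hypothesis cG : {within `[0, 1], continuous G}.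
Hypothesis GH : forall t, 0 < t < 1 -> G t = h (Q t).

Lemma stationary_marginal j (B : set R) : measurable B ->
  P (X j @^-1` B) = P (X 0%N @^-1` B).
Proof.
move=> mB; elim: j => // j <-; symmetry.
apply: (statX (B := (fun w => w j) @^-1` B)).
by apply: sub_sigma_algebra; exists j, B.
Qed.

Lemma distr_fun01 x : 0 <= F x <= 1.
Proof. by rewrite /F distr_fun_ge0 // distr_fun_le1. Qed.

(* If [F] jumps to [1] at [Q t], then [G] is constant on [[t, 1)] and continuity settles [G 1]. *)
Lemma h_quantile_distr t : 0 < t < 1 -> h (Q t) = G (F (Q t)).
Proof.
move=> t01; have /andP[t0 t1] := t01; set x := Q t; set s := F x.
have ts : t <= s by rewrite /s /x /F -quantile_le.
(* [Q] is constant on the levels from [t] up to [F (Q t)], as long as they are below 1. *)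
have Qx t' : t <= t' -> t' < 1 -> t' <= s -> Q t' = x.
  move=> tt' t'1 t's; apply/le_anti; apply/andP; split.
    by rewrite /Q quantile_le // t'1 (lt_le_trans t0).
  exact: quantile_nd.
have [s1|s1] := ltP s 1.
  by rewrite GH ?s1 ?(lt_le_trans t0) // Qx.
have {s1}sE : s = 1 by apply/le_anti; rewrite s1 andbT; case/andP: (distr_fun01 x).
apply/eqP; rewrite -subr_eq0 -normr_le0; apply/ler_addgt0Pr => e e0; rewrite add0r.
have [delta delta0 H] := within_continuous_unif01 cG e0.
(* A level in [[t, 1)] within [delta] of 1. *)
pose t' := Num.max t (1 - delta).
have t'1 : t' < 1 by rewrite gt_max t1 gtrBl.
have tt' : t <= t' by rewrite le_max lexx.
have t'0 : 0 < t' := lt_le_trans t0 tt'.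
rewrite -(Qx t') ?sE ?(ltW t'1) // -GH ?t'0 //.
apply: H; rewrite ?(ltW t'0) ?(ltW t'1) ?lexx ?ler01 //.
have : 1 - delta <= t' by rewrite le_max lexx orbT.
by rewrite distrC ger0_norm ?subr_ge0 ?(ltW t'1) //; lra.
Qed.

Lemma measurable_G_distr : measurable_fun setT (fun x => G (F x)).
Proof.
have mF : measurable_fun setT F.
  by apply: nondecreasing_measurable => //; exact: distr_fun_nd.
have mG : measurable_fun (`[0, 1]%classic : set R) G.
  by apply: subspace_continuous_measurable_fun.
apply: (@measurable_comp _ _ _ _ R _ (`[0, 1]%classic : set R) G setT F) => //.
by move=> _ [x _ <-] /=; rewrite in_itv /= distr_fun01.
Qed.

(** The Borel set [E] where the identity fails contains no quantile of a level in the open unit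
    interval. The inverse transform makes it null for the law of [X 0], and stationarity for that of
    each [X j]. *)
Lemma h_distr_ae : {ae P, forall w, forall j, h (X j w) = G (F (X j w))}.
Proof.
pose E : set R := [set x | h x != G (F x)].
have mE : measurable E.
  rewrite (_ : E = ~` [set x | h x == G (F x)]); last first.
    by apply/seteqP; split => x /= /negP.
  apply: measurableC; rewrite -[X in measurable X]setTI.
  have := measurable_fun_eqr mh measurable_G_distr.
  by move=> /(_ measurableT [set true]); apply.
apply: ae_foralln => j; exists (X j @^-1` E); split.
- by rewrite -[X in measurable X]setTI; exact: mX.
- have mXE : measurable (X 0%N @^-1` E) by rewrite -[X in measurable X]setTI; exact: mX.
  have mIE : measurable_fun setT (EFin \o (\1_E : R -> R)).
    by apply/measurable_EFinP; exact: measurable_indic.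
  transitivity (P (X 0%N @^-1` E)); first exact: stationary_marginal.
  transitivity (\int[P]_w (\1_E (X 0%N w))%:E)%E.
    transitivity (\int[P]_w (\1_(X 0%N @^-1` E) w)%:E)%E => //.
    by rewrite integral_indic // setIT.
  rewrite -(@integral_quantile01 _ _ _ P X mX (EFin \o \1_E)) //; last first.
    by move=> x; rewrite lee_fin.
  rewrite integral_unif01; last 2 first.
  + exact: (measurableT_comp mIE).
  + by move=> x; rewrite lee_fin.
  apply: integral0_eq => t /=; rewrite in_itv /= => t01.
  rewrite indicE memNset // /E /= quantile01E // => /negP; apply.
  by apply/eqP; exact: h_quantile_distr.
- by move=> w /= H; apply/eqP.
Qed.

Lemma h_bounded : exists2 C : R, 0 <= C & forall t, 0 < t < 1 -> `|h (U t)| <= C.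
Proof.
have /(@compact_bounded _ R^o) : compact (G @` `[0, 1]).
  by apply: continuous_compact => //; exact: segment_compact.
move=> [M [_ HM]]; exists (`|M| + 1); first by rewrite addr_ge0.
move=> t t01; rewrite /U quantile01E // -GH //; apply: HM.
  by rewrite (le_lt_trans (ler_norm M)) // ltrDl.
by exists t => //=; rewrite in_itv /=; case/andP: t01 => /ltW -> /ltW.
Qed.

Lemma integrable_of_continuous : P.-integrable setT (EFin \o (h \o X 0%N)).
Proof.
have [C C0 HC] := h_bounded.
apply/integrableP; split; first by apply/measurable_EFinP; exact: measurableT_comp.
have mA : measurable_fun setT (fun x => (`|h x|)%:E).
  by apply/measurable_EFinP; exact: measurableT_comp.
rewrite -(@integral_quantile01 _ _ _ P X mX (fun x => (`|h x|)%:E)) //.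
apply: (@le_lt_trans _ _ (\int[unif01]_t (C%:E))%E).
  apply: le_integral_unif01 => //.
  by apply: (measurableT_comp mA).
by rewrite integral_cst // [X in (_ * X)%E]probability_setT mule1 ltry.
Qed.

Lemma emp_quantile_mem n w t : (0 < n)%N -> 0 < t <= 1 ->
  exists j, V n w t = X j w.
Proof.
move=> n0 t01; have [i [/andP[i0 i_n] _ _ cE]] := cfun_cell n0 t01.
rewrite /V /emp_quantile cE /order_stat.
have : nth 0 (sort <=%R [seq X j w | j <- iota 0 n]) i.-1 \in
    sort <=%R [seq X j w | j <- iota 0 n].
  by apply: mem_nth; rewrite size_sort size_map size_iota prednK.
by rewrite mem_sort => /mapP[j _ ->]; exists j.
Qed.

(** By the inverse transform this is the measure of the levels [t] whose quantile is below [Q s],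
    and monotonicity forces such [t] to be at most [s]. *)
Lemma prob_lt_quantile s : 0 < s < 1 -> fine (P (X 0%N @^-1` `]-oo, Q s[)) <= s.
Proof.
move=> s01; have /andP[s0 s1] := s01.
have mI (B : set R) : measurable B -> measurable_fun setT (EFin \o (\1_B : R -> R)).
  by move=> mB; apply/measurable_EFinP; exact: measurable_indic.
pose A : set R := `]-oo, Q s[%classic.
have mA : measurable A by exact: measurable_itv.
have mXA : measurable (X 0%N @^-1` A) by rewrite -[X in measurable X]setTI; exact: mX.
rewrite -lee_fin fineK ?fin_num_measure //.
have -> : P (X 0%N @^-1` A) = (\int[P]_w (EFin \o \1_A) (X 0%N w))%E.
  transitivity (\int[P]_w (\1_(X 0%N @^-1` A) w)%:E)%E => //.
  by rewrite integral_indic // setIT.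
rewrite -(@integral_quantile01 _ _ _ P X mX (EFin \o \1_A)); last 2 first.
- exact: mI.
- by move=> x; rewrite lee_fin.
have <- : unif01 (`]-oo, s]%classic : set R) = s%:E.
  by apply: unif01_initial; rewrite ?(ltW s0) ?(ltW s1).
have mB : measurable (`]-oo, s]%classic : set R) by exact: measurable_itv.
have -> : unif01 (`]-oo, s]%classic : set R) =
    (\int[unif01]_t (\1_(`]-oo, s]%classic : set R) t)%:E)%E.
  by rewrite integral_indic // setIT.
apply: le_integral_unif01.
- exact: (measurableT_comp (mI _ mA)).
- by move=> t; rewrite lee_fin.
- exact: mI.
- by move=> t; rewrite lee_fin.
move=> t t01; rewrite lee_fin !indicE.
have [At|nAt] := boolP (quantile01 P X t \in A) => //.
rewrite mem_set //= in_itv /= leNgt; apply/negP => st.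
move: At; rewrite inE /A /= in_itv /= quantile01E // ltNge => /negP; apply.
by apply: quantile_nd => //; [exact: ltW|case/andP: t01].
Qed.

End ContinuousCondition.

(** * Comparison on a finite grid of levels *)

Section ContinuousTheorem.
Context {d : measure_display} {T : measurableType d} {R : realType}.
Variables (P : probability T R) (X : nat -> T -> R).
Hypothesis mX : forall n, measurable_fun setT (X n).
Hypothesis statX : strictly_stationary P X.
Hypothesis ergX : ergodic_seq P X.
Variables (h : R -> R) (c : nat -> nat -> R).
Hypothesis mh : measurable_fun setT h.
Let F := distr_fun P X.
Let Q := quantile F.
Let U := quantile01 P X.
Let V := emp_quantile X.
Variable G : R -> R.
Hypothesis cG : {within `[0, 1], continuous G}.
Hypothesis GH : forall t, 0 < t < 1 -> G t = h (Q t).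

Let grid m j : R := j%:R / m%:R.

(** Only one-sided bounds can be expected: if [F] jumps at [Q s], its value there may exceed [s] and
    its left limit may be smaller than [s]. *)
Let grid_good m n w := forall j, (0 < j < m)%N ->
  grid m j - m%:R^-1 <= emp_mean X (fun y => (y <= Q (grid m j))%R%:R) n w /\
  emp_mean X (fun y => (y < Q (grid m j))%R%:R) n w <= grid m j + m%:R^-1.

(** The strong law for closed and open half-lines ending at the grid quantiles, combined with
    [F (Q s) >= s] and [prob_lt_quantile]; finitely many levels are treated for each [m]. *)
Lemma grid_good_ae : {ae P, forall w, forall m, (0 < m)%N ->
  \forall n \near \oo, grid_good m n w}.
Proof.
have le_ae := ae_foralln (fun m => ae_foralln (fun j =>
  emp_mean_indic_cvg mX statX ergX (measurable_itv `]-oo, Q (grid m j)]))).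
have lt_ae := ae_foralln (fun m => ae_foralln (fun j =>
  emp_mean_indic_cvg mX statX ergX (measurable_itv `]-oo, Q (grid m j)[))).
apply: filterS2 le_ae lt_ae => w le_w lt_w m m0.
have m0R : 0 < m%:R :> R by rewrite ltr0n.
have mV0 : 0 < m%:R^-1 :> R by rewrite invr_gt0.
have H (j : 'I_m) : \forall n \near \oo, (0 < j)%N ->
  grid m j - m%:R^-1 <= emp_mean X (fun y => (y <= Q (grid m j))%R%:R) n w /\
  emp_mean X (fun y => (y < Q (grid m j))%R%:R) n w <= grid m j + m%:R^-1.
  have Hle : \forall n \near \oo, `|fine (P (X 0%N @^-1` `]-oo, Q (grid m j)])) -
      emp_mean X \1_(`]-oo, Q (grid m j)]%classic : set R) n w| <= m%:R^-1.
    exact: (cvgrPdist_le _ _).1 (le_w m j) _ mV0.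
  have Hlt : \forall n \near \oo, `|fine (P (X 0%N @^-1` `]-oo, Q (grid m j)[)) -
      emp_mean X \1_(`]-oo, Q (grid m j)[%classic : set R) n w| <= m%:R^-1.
    exact: (cvgrPdist_le _ _).1 (lt_w m j) _ mV0.
  apply: filterS2 Hle Hlt => n Hle Hlt j0.
  have s01 : 0 < grid m j < 1.
    by rewrite divr_gt0 ?ltr0n //= ltr_pdivrMr // mul1r ltr_nat.
  have leE : emp_mean X (fun y => (y <= Q (grid m j))%R%:R) n w =
      emp_mean X \1_(`]-oo, Q (grid m j)]%classic : set R) n w.
    congr (_ * _); apply: eq_bigr => i _; rewrite indicE; congr ((nat_of_bool _)%:R).
    by apply/idP/idP; rewrite inE /= in_itv.
  have ltE : emp_mean X (fun y => (y < Q (grid m j))%R%:R) n w =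
      emp_mean X \1_(`]-oo, Q (grid m j)[%classic : set R) n w.
    congr (_ * _); apply: eq_bigr => i _; rewrite indicE; congr ((nat_of_bool _)%:R).
    by apply/idP/idP; rewrite inE /= in_itv.
  rewrite leE ltE; split.
    have FQ : grid m j <= F (Q (grid m j)) by rewrite /F -quantile_le.
    have FE : fine (P (X 0%N @^-1` `]-oo, Q (grid m j)])) = F (Q (grid m j)).
      by congr (fine (P _)); apply/seteqP; split => y /=; rewrite in_itv.
    move: Hle; rewrite FE ler_distl => /andP[]; move: FQ; lra.
  have PQ := prob_lt_quantile P mX s01.
  move: Hlt; rewrite ler_distl => /andP[]; move: PQ; rewrite -/F -/Q; lra.
apply: filterS (filter_forall _ H) => n Hn j /andP[j0 jm].
exact: (Hn (Ordinal jm)).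
Qed.

(** With [k / m <= t < (k + 1) / m], the levels [(k - 2) / m] and [(k + 2) / m] leave room for the
    error [1 / m] of [grid_good], so [V n w t] lies between their quantiles. *)
Lemma h_emp_quantile m n w t : (0 < n)%N -> (0 < m)%N -> grid_good m n w ->
  (forall j, h (X j w) = G (F (X j w))) -> 0 < t < 1 ->
  exists u, [/\ 0 <= u <= 1, `|u - t| <= 3 / m%:R & h (V n w t) = G u].
Proof.
move=> n0 m0 good hG t01; have /andP[t0 t1] := t01.
have t01' : 0 < t <= 1 by rewrite t0 ltW.
have m0R : 0 < m%:R :> R by rewrite ltr0n.
have mVm : m%:R * m%:R^-1 = 1 :> R by rewrite mulfV ?gt_eqF.
have v0 : 0 < m%:R^-1 :> R by rewrite invr_gt0.
set v : R := m%:R^-1 in v0 mVm *.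
have [j yE] := emp_quantile_mem X w n0 t01'.
set y := V n w t; have hy : h y = G (F y) by rewrite /y /V yE.
have F01 : 0 <= F y <= 1 by exact: distr_fun01.
have tm0 : 0 <= t * m%:R by rewrite mulr_ge0 ?(ltW t0).
pose k := Num.truncn (t * m%:R).
have /andP[kt tk] := truncn_itv tm0; rewrite -/k in kt tk.
have kt' : k%:R * v <= t by rewrite ler_pdivrMr.
have tk' : t < k.+1%:R * v by rewrite ltr_pdivlMr.
have S (i : nat) : i.+1%:R * v = i%:R * v + v by rewrite -natr1 mulrDl mul1r.
have lowF : t - 3 * v <= F y.
  (* For [k] at most 2 the lower level may leave the grid, but then [t - 3 / m] is negative. *)
  have [k2|k3] := leqP k 2.
    have : k%:R * v <= 2%:R * v by rewrite ler_wpM2r ?(ltW v0) // ler_nat.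
    by move: tk'; rewrite S; case/andP: F01; lra.
  have [i kE] : exists i, k = i.+3 by exists (k - 3)%N; rewrite -addn3 subnK.
  have i0m : (0 < i.+1 < m)%N.
    have : k%:R < m%:R :> R.
      by apply: le_lt_trans kt _; rewrite gtr_pMl.
    by rewrite ltr_nat kE /= => /ltnW/ltnW.
  have s01 : 0 < grid m i.+1 < 1.
    case/andP: i0m => _ im.
    by rewrite divr_gt0 ?ltr0n //= ltr_pdivrMr // mul1r ltr_nat.
  have [_ b] := good _ i0m.
  have Qy : Q (grid m i.+1) <= y.
    rewrite leNgt emp_quantile_lt // -ltNge; apply: le_lt_trans b _.
    by rewrite /grid -/v; move: kt' tk'; rewrite kE !S; lra.
  have : grid m i.+1 <= F y by rewrite /F -quantile_le.
  by rewrite /grid -/v; move: kt' tk'; rewrite kE !S; lra.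
(* When the upper level reaches 1, the bound [F y <= 1] replaces it. *)
have [mk|km] := leqP m k.+2.
  exists (F y); split => //; rewrite ler_norml; apply/andP; split; first by move: lowF; lra.
  have : 1 <= k.+2%:R * v by rewrite -[leLHS]mVm ler_wpM2r ?(ltW v0) // ler_nat.
  by move: kt'; rewrite !S; case/andP: F01; lra.
have j0m : (0 < k.+2 < m)%N by [].
have s01 : 0 < grid m k.+2 < 1.
  by rewrite divr_gt0 ?ltr0n //= ltr_pdivrMr // mul1r ltr_nat.
have [a _] := good _ j0m.
have yQ : y <= Q (grid m k.+2).
  rewrite emp_quantile_le //; apply: le_trans _ a.
  by rewrite /grid -/v; move: tk'; rewrite !S; lra.
have [Fs|sF] := leP (F y) (grid m k.+2).
  exists (F y); split => //; rewrite ler_norml; apply/andP; split; first by move: lowF; lra.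
  by move: Fs kt'; rewrite /grid -/v !S; lra.
(* At a jump of [F] the value [F y] may be far above [t]; but then [y] is the grid quantile itself,
   and the level [(k + 2) / m] serves as [u]. *)
have yE' : y = Q (grid m k.+2).
  apply/le_anti; rewrite yQ /=.
  by rewrite /Q /F quantile_le // (ltW sF).
exists (grid m k.+2); split.
- by case/andP: s01 => /ltW -> /ltW.
- by rewrite ler_norml /grid -/v; move: kt' tk'; rewrite !S; lra.
- by rewrite yE' GH.
Qed.

(** Uniform continuity of [G] makes [h (V n w t) - h (U t)] uniformly small in [t], and the integral
    of [|c_n|] is at most [M]. *)
Theorem Lstat_cvg_continuous :
  (exists M, forall n, (0 < n)%N -> Cq c n 1 <= M) ->
  {ae P, forall w, (fun n => Lstat X h c n w - Lmean P X h c n) @ \oo --> 0}.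
Proof.
move=> [M HM].
apply: filterS2 grid_good_ae (h_distr_ae mX statX mh cG GH) => w good hG.
apply/cvgrPdist_le => e e0.
have M1 : 0 < `|M| + 1 by rewrite ltr_wpDl.
have e'0 : 0 < e / (`|M| + 1) by rewrite divr_gt0.
have [delta delta0 HG] := within_continuous_unif01 cG e'0.
(* The grid is fine enough for the displacement [3 / m] to be within the modulus [delta]. *)
pose m := (Num.bound (3 / delta)).+1.
have m0 : (0 < m)%N by [].
have md : 3 / m%:R <= delta.
  rewrite ler_pdivrMr ?ltr0n // mulrC -ler_pdivrMr //.
  apply: le_trans (ltW (archi_boundP _)) _; first by rewrite divr_ge0 // ltW.
  by rewrite ler_nat.
apply: filterS2 (good m m0) (nbhs_infty_gt 0) => n gn n0.
rewrite sub0r normrN -lee_fin.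
apply: le_trans (Lstat_sub_le mX c mh (integrable_of_continuous mX mh cG GH) w n0) _.
pose a n i := `|c n i|.
have a0 i : 0 <= a n i by exact: normr_ge0.
have mU : measurable_fun setT U := measurable_quantile01 P mX.
have mV := measurable_emp_quantile X n w.
have ma := measurable_cfun a n.
have acf0 t : 0 <= cfun a n t.
  rewrite /cfun addr_ge0 //; first by case: ifP.
  by apply: sumr_ge0 => i _; case: ifP.
have CM : n%:R^-1 * \sum_(1 <= i < n.+1) a n i <= M.
  apply: le_trans (HM n n0); rewrite /Cq ler_wpM2l ?invr_ge0 // ler_sum // => i _.
  by rewrite powRr1.
apply: (@le_trans _ _ (\int[unif01]_t (e / (`|M| + 1) * cfun a n t)%:E)%E).
  apply: le_integral_unif01.
  - apply/measurable_EFinP; apply: measurable_funM.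
      by apply: measurableT_comp => //; exact: measurable_cfun.
    by apply: measurableT_comp => //; apply: measurable_funB; exact: measurableT_comp.
  - by move=> t; rewrite lee_fin mulr_ge0.
  - by apply/measurable_EFinP; exact: measurable_funM.
  - by move=> t; rewrite lee_fin mulr_ge0 // ltW.
  move=> t t01; rewrite lee_fin.
  have /andP[t0 t1] := t01; have t01' : 0 < t <= 1 by rewrite t0 ltW.
  have [i [_ _ _ cE]] := cfun_cell n0 t01'; rewrite !cE mulrC ler_wpM2r //.
  rewrite quantile01E // -/F -/Q -GH //.
  have [u [u01 ut ->]] := h_emp_quantile n0 m0 gn hG t01.
  apply: HG => //; last exact: le_trans ut md.
  by rewrite (ltW t0) (ltW t1).
rewrite unif01Z ?(ltW e'0) // integral_unif01_cfun // -EFinM lee_fin.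
apply: (@le_trans _ _ (e / (`|M| + 1) * (`|M| + 1))); last by rewrite divfK // gt_eqF.
rewrite ler_wpM2l ?(ltW e'0) // (le_trans CM) // (le_trans (ler_norm M)) //.
by rewrite lerDl.
Qed.

End ContinuousTheorem.

Theorem theorem1 (d : measure_display) (T : measurableType d) (R : realType)
  (P : probability T R) (X : nat -> T -> R) (h : R -> R)
  (c : nat -> nat -> R) :
  (forall n, measurable_fun setT (X n)) ->
  strictly_stationary P X ->
  ergodic_seq P X ->
  measurable_fun setT h ->
  let F := distr_fun P X in
  let H := fun t => h (quantile F t) in
  let mu := fun n => Rintegral lebesgue_measure `[0, 1] (fun t => cfun c n t * H t) in
  ( (* condition (i) *)
    ((exists G : R -> R, {within `[0, 1], continuous G} /\
                         (forall t, 0 < t < 1 -> G t = H t)) /\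
     (exists M, forall n, (0 < n)%N -> Cq c n 1 <= M))
    \/
    (* condition (ii) *)
    (exists p : R, 1 <= p /\
       (\int[P]_w ((`|h (X 0%N w)| `^ p)%:E) < +oo)%E /\
       (if p == 1 then exists M, forall n, (0 < n)%N -> Cinf c n <= M
        else exists M, forall n, (0 < n)%N -> Cq c n (p / (p - 1)) <= M))) ->
  {ae P, forall w, (fun n => Lstat X h c n w - mu n) @ \oo --> 0}.
Proof.
move=> mX statX ergX mh F H mu [[[G [cG GH]] cM]|[p [p1 [hp cM]]]].
  exact: (Lstat_cvg_continuous mX statX ergX mh cG GH cM).
exact: (Lstat_cvg_Lp mX statX ergX mh p1 hp cM).
Qed.
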